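(* Let $i>0$ and let $\mathfrak{A}_i$ be a family of collections of subforests satisfying Assumptions 1 and 2 recalled in the context. Then the map $\Delta_i$ is coassociative and multiplicative on $\langle\mathfrak{F}\rangle$, namely the identities $$(\Delta_i\otimes\mathrm{id})\Delta_i\mathcal{F}=(\mathrm{id}\otimes\Delta_i)\Delta_i\mathcal{F},\qquad \Delta_i(\mathcal{F}\cdot\mathcal{G})=(\Delta_i\mathcal{F})\cdot(\Delta_i\mathcal{G})$$ hold for all $\mathcal{F},\mathcal{G}\in\langle\mathfrak{F}\rangle$.
   Context: Decorated forests. $\mathbb{N}=\{0,1,2,\dots\}$; fix an integer $d\ge1$ and a finite set $\mathfrak{L}$ of types; $\mathbb{Z}(\mathfrak{L})$ is the free abelian group on $\mathfrak{L}$. A typed rooted forest $F$ is a finite, possibly empty, forest with node set $N_F$, edge set $E_F$, a distinguished root in each connected component, edges written $(x,y)$ with $x$ nearer to the root, and a type map $\mathfrak{t}:E_F\to\mathfrak{L}$. A subforest $A\subset F$ is given by $E_A\subset E_F$, $N_A\subset N_F$ with $N_A$ containing all endpoints of edges in $E_A$; subforests are disjoint ($A\cap B=\emptyset$) if their node sets are. A coloured forest is a pair $(F,\hat F)$ with $\hat F:E_F\sqcup N_F\to\mathbb{N}$ such that $\hat F(x)=\hat F(y)=\hat F(e)$ whenever $e=(x,y)\in E_F$ has $\hat F(e)\ne0$. For $i>0$, $\hat F_i$ is the subforest of nodes and edges of colour $i$. A decorated forest $(F,\hat F,\mathfrak{n},\mathfrak{o},\mathfrak{e})$ is a coloured forest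 with maps $\mathfrak{n}:N_F\to\mathbb{N}^d$, $\mathfrak{o}:N_F\to\mathbb{Z}^d\oplus\mathbb{Z}(\mathfrak{L})$ vanishing where $\hat F=0$, and $\mathfrak{e}:E_F\to\mathbb{N}^d$ vanishing where $\hat F\ne0$. Isomorphic decorated forests are identified; $\mathfrak{F}$ is the set of all of them. The forest product $\cdot$ is disjoint union (with the decorations and colours inherited). Bigrading. $|(F,\hat F,\mathfrak{n},\mathfrak{o},\mathfrak{e})|_{\mathrm{bi}}=(n_1,n_2)$ with $n_1=\sum_{e\in E_F}\sum_{j=1}^d\mathfrak{e}(e)_j$ and $n_2$ the number of nodes and edges of colour $0$ that are not roots. $\langle\mathfrak{F}\rangle$ is the space of formal series $\sum_{n\in\mathbb{N}^2}v_n$ with $v_n$ in the free real vector space $V_n$ generated by $\{\tau\in\mathfrak{F}:|\tau|_{\mathrm{bi}}=n\}$ and such that, for some $k$, $v_n=0$ whenever $n_2>k$. For two such bigraded spaces $V,W$, $V\hat\otimes W$ is the space of formal series $\sum_n u_n$ with $u_n\in\bigoplus_{m+\ell=n}V_m\otimes W_\ell$ and $u_n=0$ for $n_2$ large. All maps are extended to such series and their (iterated) tensor products; the product on $\langle\mathfrak F\rangle\hat\otimes\langle\mathfrak F\rangle$ is componentwise. Assumption 1 (for $\mathfrak{A}_i$). To each coloured forest $(F,\hat F)$ is associated a collection $\mathfrak{A}_i(F,\hat F)$ of subforests of $F$, compatible with isomorphisms of coloured forests, such that every $A\in\mathfrak{A}_i(F,\hat F)$ satisfies: (1) $\hat F_i\subset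 A$ and $\hat F_j\cap A=\emptyset$ for every $j>i$; (2) for every $0<j<i$ and every connected component $T$ of $\hat F_j$, either $T\subset A$ or $T\cap A=\emptyset$. Write $\hat F\restriction A$ for the restriction of $\hat F$ to $A$ and $\hat F\cup_iA$ for the colouring equal to $i$ on $N_A\sqcup E_A$ and to $\hat F$ elsewhere. Assumption 2. (1) $\mathfrak{A}_i(F\sqcup G,\hat F+\hat G)=\{C\sqcup D: C\in\mathfrak{A}_i(F,\hat F),\,D\in\mathfrak{A}_i(G,\hat G)\}$. (2) One has [$A\in\mathfrak{A}_i(F,\hat F)$ and $B\in\mathfrak{A}_i(F,\hat F\cup_iA)$] if and only if [$B\in\mathfrak{A}_i(F,\hat F)$ and $A\in\mathfrak{A}_i(B,\hat F\restriction B)$]. The map $\Delta_i:\langle\mathfrak{F}\rangle\to\langle\mathfrak{F}\rangle\hat\otimes\langle\mathfrak{F}\rangle$ is given on $\tau=(F,\hat F,\mathfrak{n},\mathfrak{o},\mathfrak{e})$ by $$\Delta_i\tau=\sum_{A\in\mathfrak{A}_i(F,\hat F)}\sum_{\varepsilon,\mathfrak{n}_A}\frac{1}{\varepsilon!}\binom{\mathfrak{n}}{\mathfrak{n}_A}(A,\hat F\restriction A,\mathfrak{n}_A+\pi\varepsilon,\mathfrak{o}\restriction N_A,\mathfrak{e}\restriction E_A)\otimes(F,\hat F\cup_iA,\mathfrak{n}-\mathfrak{n}_A,\mathfrak{o}+\mathfrak{n}_A+\pi(\varepsilon-\mathfrak{e}\mathbf{1}_{E_A}),\mathfrak{e}\mathbf{1}_{E_F\setminus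 E_A}+\varepsilon),$$ where $\mathfrak{n}_A$ runs over maps $N_F\to\mathbb{N}^d$ supported in $N_A$, $\varepsilon$ over maps $E_F\to\mathbb{N}^d$ supported in $\{(x,y)\in E_F\setminus E_A:x\in N_A\}$, $(\pi\varepsilon)(x)=\sum_{e=(x,y)\in E_F}\varepsilon(e)$, and factorials and binomial coefficients are products over all nodes/edges and components (a binomial coefficient vanishes unless $0\le\mathfrak{n}_A\le\mathfrak{n}$). *)

(* Defs.v *)
From HB Require Import structures.
From mathcomp Require Import all_boot all_order all_algebra.
From mathcomp Require Import all_classical all_reals.

Set Implicit Arguments.
Unset Strict Implicit.
Unset Printing Implicit Defensive.

Import Order.TTheory GRing.Theory Num.Theory.

(* Finite types whose carrier is in [Set]: over these, forests form a type small
   enough to be a [choiceType], as [finType] is not. *)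
Record smallFinType : Type := SmallFinType {
  small_sort : Set;
  small_class : Finite.axioms_ small_sort }.

Definition finType_of_small (N : smallFinType) : finType :=
  Finite.Pack (small_class N).
Coercion finType_of_small : smallFinType >-> Finite.type.

Definition small_sub (N : smallFinType) (A : {set N}) : smallFinType :=
  @SmallFinType {x : small_sort N | (x : N) \in A}
    (Finite.class {x : N | x \in A}).

Definition small_sum (N M : smallFinType) : smallFinType :=
  @SmallFinType (small_sort N + small_sort M)%type
    (Finite.class (N + M)%type).

Definition arc (N E : finType) (s t : E -> N) : rel N :=
  fun x y => [exists e, (s e == x) && (t e == y)].

(* An edge [(x, y)], with [x] nearer to the root, is an [e : edge F] with
   [src e = x] and [tgt e = y].  With this orientation a rooted forest is an
   acyclic directed graph in which every node has at most one incoming edge;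
   the roots are the nodes without incoming edge, see [forest_root]. *)
Record forest (L : finType) : Type := Forest {
  node : smallFinType;
  edge : smallFinType;
  src : edge -> node;
  tgt : edge -> node;
  typ : edge -> L;
  tgt_inj : injective tgt;
  src_tgt_acyclic : forall e, ~~ connect (arc src tgt) (tgt e) (src e) }.

Arguments src {L f}.
Arguments tgt {L f}.
Arguments typ {L f}.

Definition is_root (L : finType) (F : forest L) (x : node F) : bool :=
  [forall e, tgt e != x].

Lemma forest_root (L : finType) (F : forest L) (x : node F) :
  exists! r, is_root r /\ connect (arc (@src L F) tgt) r x.
Proof.
have uniq_root r r' : is_root r -> is_root r' ->
    connect (arc (@src L F) tgt) r x -> connect (arc (@src L F) tgt) r' x ->
    r = r'.
  move=> rr rr' /connectP[p]; elim/last_ind: p x => [|p z IH] x /=.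
    move=> _ -> /connectP[q]; case/lastP: q => [|q z] //=.
    rewrite rcons_path last_rcons => /andP[_ /existsP[e /andP[_ /eqP te]]] rz.
    by move/forallP: rr => /(_ e); rewrite te rz eqxx.
  rewrite rcons_path last_rcons => /andP[rp /existsP[e /andP[/eqP se /eqP te]]].
  move=> xz /connectP[q]; case/lastP: q => [|q y] /=.
    by move=> _ xr'; move/forallP: rr' => /(_ e); rewrite te -xz xr' eqxx.
  rewrite rcons_path last_rcons => /andP[rq /existsP[e' /andP[/eqP se' /eqP te']]].
  move=> xy; have ee' : e = e' by apply: (@tgt_inj _ F); rewrite te te' -xz.
  apply: (IH (last r p)) => //; apply/connectP; exists q => //.
  by rewrite -se -se' ee'.
have [n] := ubnP #|[set y | connect (arc (@src L F) tgt) y x]|.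
suff ex : forall n y, #|[set z | connect (arc (@src L F) tgt) z y]| < n ->
    exists2 r, is_root r & connect (arc (@src L F) tgt) r y.
  move=> /ex[r rr rx]; exists r; split=> // r' [rr' r'x].
  exact: uniq_root.
elim=> // {}n IH y; rewrite ltnS => yn.
case: (boolP (is_root y)) => [ry|/forallPn[e]]; first by exists y.
rewrite negbK => /eqP te.
have sy : connect (arc (@src L F) tgt) (src e) y.
  by apply: connect1; apply/existsP; exists e; rewrite eqxx te eqxx.
have [|r rr re] := IH (src e); last by exists r => //; apply: connect_trans sy.
apply: leq_trans yn; apply: proper_card; apply/properP; split.
  by apply/fintype.subsetP => z; rewrite !inE => /connect_trans; apply.
by exists y; rewrite !inE // -te; apply: src_tgt_acyclic.
Qed.

Section Subforests.
Context {L : finType} (F : forest L).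

Definition endpoints_in (A : {set node F} * {set edge F}) : bool :=
  [forall e in A.2, (src e \in A.1) && (tgt e \in A.1)].

Record subforest : Type := Subforest {
  sub_sets :> {set node F} * {set edge F};
  subforestP : endpoints_in sub_sets }.

HB.instance Definition _ := [isSub for sub_sets].
HB.instance Definition _ := [Finite of subforest by <:].

Lemma sub_src (A : subforest) e : e \in A.2 -> src e \in A.1.
Proof. by case: A => A /= /forall_inP h /h /andP[]. Qed.

Lemma sub_tgt (A : subforest) e : e \in A.2 -> tgt e \in A.1.
Proof. by case: A => A /= /forall_inP h /h /andP[]. Qed.

Definition included (A B : {set node F} * {set edge F}) : bool :=
  (A.1 \subset B.1) && (A.2 \subset B.2).

Definition disjoint_sub (A B : {set node F} * {set edge F}) : bool :=
  [disjoint A.1 & B.1].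

Definition adjacent (B : {set node F} * {set edge F}) : rel (node F) :=
  fun x y => [exists e in B.2, (src e == x) && (tgt e == y)
                            || (src e == y) && (tgt e == x)].

Definition component (B : {set node F} * {set edge F}) (x : node F) :
    {set node F} * {set edge F} :=
  ([set y in B.1 | connect (adjacent B) x y],
   [set e in B.2 | connect (adjacent B) x (src e)]).

Definition is_component (B T : {set node F} * {set edge F}) : Prop :=
  exists2 x, x \in B.1 & T = component B x.

Definition sub_node (A : subforest) : smallFinType := small_sub A.1.
Definition sub_edge (A : subforest) : smallFinType := small_sub A.2.

Definition restr_src (A : subforest) (e : sub_edge A) : sub_node A :=
  exist _ (src (val e)) (sub_src (valP e)).
Definition restr_tgt (A : subforest) (e : sub_edge A) : sub_node A :=
  exist _ (tgt (val e)) (sub_tgt (valP e)).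

Lemma restr_tgt_inj (A : subforest) : injective (@restr_tgt A).
Proof.
by move=> e e' h; apply: val_inj; apply: (@tgt_inj _ F); apply: (congr1 val h).
Qed.

Lemma restr_acyclic (A : subforest) (e : sub_edge A) :
  ~~ connect (arc (@restr_src A) (@restr_tgt A)) (restr_tgt e) (restr_src e).
Proof.
have conn (x y : sub_node A) : connect (arc (@restr_src A) (@restr_tgt A)) x y ->
    connect (arc (@src _ F) tgt) (val x) (val y).
  case/connectP => p; elim: p x => [|z p IH] x /=; first by move=> _ ->.
  move=> /andP[/existsP[e' /andP[/eqP <- /eqP <-]] zp] /(IH _ zp).
  apply: connect_trans; apply: connect1; apply/existsP; exists (val e').
  by rewrite /= !eqxx.
by apply/negP => /conn; apply/negP; apply: (@src_tgt_acyclic _ F).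
Qed.

Definition restr (A : subforest) : forest L :=
  @Forest L (sub_node A) (sub_edge A) (@restr_src A) (@restr_tgt A)
    (fun e => typ (val e)) (@restr_tgt_inj A) (@restr_acyclic A).

End Subforests.

(* [A], when [A] is included in [B], seen as a subforest of the forest [B]. *)
Section Inside.
Context {L : finType} {F : forest L}.

Definition inside_sets (B A : subforest F) :
    {set node (restr B)} * {set edge (restr B)} :=
  ([set x : sub_node B | val x \in A.1], [set e : sub_edge B | val e \in A.2]).

Lemma inside_subproof (B A : subforest F) : endpoints_in (inside_sets B A).
Proof.
apply/forall_inP => e; rewrite !inE => eA.
by apply/andP; split; [apply: sub_src eA|apply: sub_tgt eA].
Qed.

Definition inside (B A : subforest F) : subforest (restr B) :=
  Subforest (inside_subproof B A).
End Inside.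

Section Sum.
Context {L : finType} (F G : forest L).

Definition sum_src (e : edge F + edge G) : node F + node G :=
  match e with inl e => inl (src e) | inr e => inr (src e) end.
Definition sum_tgt (e : edge F + edge G) : node F + node G :=
  match e with inl e => inl (tgt e) | inr e => inr (tgt e) end.
Definition sum_typ (e : edge F + edge G) : L :=
  match e with inl e => typ e | inr e => typ e end.

Lemma sum_tgt_inj : injective sum_tgt.
Proof. by move=> [e|e] [e'|e'] // [/tgt_inj->]. Qed.

Lemma sum_acyclic e : ~~ connect (arc sum_src sum_tgt) (sum_tgt e) (sum_src e).
Proof.
have conn x y : connect (arc sum_src sum_tgt) x y ->
    match x, y with
    | inl x, inl y => connect (arc (@src _ F) tgt) x y
    | inr x, inr y => connect (arc (@src _ G) tgt) x y
    | _, _ => false end.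
  case/connectP => p; elim: p x => [|z p IH] x /=.
    by move=> _ ->; case: x => x; apply: connect0.
  move=> /andP[/existsP[e' /andP[/eqP <- /eqP <-]] zp] /(IH _ zp).
  case: e' {zp} => e' /=; case: y {IH} => y //; apply: connect_trans;
    by apply: connect1; apply/existsP; exists e'; rewrite !eqxx.
by apply/negP => /conn; case: e => e; apply/negP; apply: src_tgt_acyclic.
Qed.

Definition forest_sum : forest L :=
  @Forest L (small_sum (node F) (node G)) (small_sum (edge F) (edge G))
    sum_src sum_tgt sum_typ sum_tgt_inj sum_acyclic.

Definition subforest_sum_sets (C : subforest F) (D : subforest G) :
    {set node forest_sum} * {set edge forest_sum} :=
  ([set x : node F + node G |
      match x with inl x => x \in C.1 | inr x => x \in D.1 end],
   [set e : edge F + edge G |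
      match e with inl e => e \in C.2 | inr e => e \in D.2 end]).

Lemma subforest_sum_subproof (C : subforest F) (D : subforest G) :
  endpoints_in (subforest_sum_sets C D).
Proof.
apply/forall_inP => -[e|e]; rewrite !inE => eA;
by apply/andP; split; [apply: sub_src eA|apply: sub_tgt eA].
Qed.

Definition subforest_sum (C : subforest F) (D : subforest G) :
    subforest forest_sum := Subforest (subforest_sum_subproof C D).
End Sum.

Record forest_iso (L : finType) (F G : forest L) : Type := ForestIso {
  iso_node : node F -> node G;
  iso_edge : edge F -> edge G;
  iso_node_bij : bijective iso_node;
  iso_edge_bij : bijective iso_edge;
  iso_src : forall e, src (iso_edge e) = iso_node (src e);
  iso_tgt : forall e, tgt (iso_edge e) = iso_node (tgt e);
  iso_typ : forall e, typ (iso_edge e) = typ e }.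

Section IsoOps.
Context {L : finType}.

Definition iso_id (F : forest L) : forest_iso F F :=
  @ForestIso L F F id id (Bijective (fun=> erefl) (fun=> erefl))
    (Bijective (fun=> erefl) (fun=> erefl))
    (fun=> erefl) (fun=> erefl) (fun=> erefl).

Lemma iso_inverse (F G : forest L) (f : forest_iso F G) :
  exists g : forest_iso G F,
    cancel (iso_node f) (iso_node g) /\ cancel (iso_edge f) (iso_edge g) /\
    cancel (iso_node g) (iso_node f) /\ cancel (iso_edge g) (iso_edge f).
Proof.
case: f => n e [n' nK n'K] [e' eK e'K] s t y /=.
unshelve eexists (@ForestIso L G F n' e' _ _ _ _ _) => //=; first by exists n.
- by exists e.
- by move=> x; apply: (can_inj nK); rewrite n'K -s e'K.
- by move=> x; apply: (can_inj nK); rewrite n'K -t e'K.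
- by move=> x; rewrite -y e'K.
Qed.

Definition iso_comp (F G H : forest L) (f : forest_iso F G)
    (g : forest_iso G H) : forest_iso F H :=
  @ForestIso L F H (iso_node g \o iso_node f) (iso_edge g \o iso_edge f)
    (bij_comp (iso_node_bij g) (iso_node_bij f))
    (bij_comp (iso_edge_bij g) (iso_edge_bij f))
    (fun e => etrans (iso_src g (iso_edge f e)) (congr1 _ (iso_src f e)))
    (fun e => etrans (iso_tgt g (iso_edge f e)) (congr1 _ (iso_tgt f e)))
    (fun e => etrans (iso_typ g (iso_edge f e)) (iso_typ f e)).

End IsoOps.

Section Image.
Context {L : finType} {F G : forest L}.

Definition image_sets (f : forest_iso F G) (A : subforest F) :
    {set node G} * {set edge G} :=
  (iso_node f @: A.1, iso_edge f @: A.2)%SET.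

Lemma image_subproof (f : forest_iso F G) (A : subforest F) :
  endpoints_in (image_sets f A).
Proof.
apply/forall_inP => _ /imsetP[e eA ->].
rewrite iso_src iso_tgt; apply/andP; split; apply: imset_f.
  exact: sub_src eA.
exact: sub_tgt eA.
Qed.

Definition image_sub (f : forest_iso F G) (A : subforest F) : subforest G :=
  Subforest (image_subproof f A).
End Image.

Record cforest (L : finType) : Type := CForest {
  cforest_forest :> forest L;
  ncol : node cforest_forest -> nat;
  ecol : edge cforest_forest -> nat;
  col_edge : forall e, ecol e != 0 ->
    ncol (src e) = ecol e /\ ncol (tgt e) = ecol e }.

Arguments ncol {L c}.
Arguments ecol {L c}.

(* This is a subforest for [0 < j] only. *)
Definition colour_class (L : finType) (F : cforest L) (j : nat) :
    {set node F} * {set edge F} :=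
  ([set x | ncol x == j], [set e | ecol e == j]).

Definition col_preserving (L : finType) (F G : cforest L)
    (f : forest_iso F G) : Prop :=
  (forall x, ncol (iso_node f x) = ncol x) /\
  (forall e, ecol (iso_edge f e) = ecol e).

Definition admissible (L : finType) (i : nat) (F : cforest L)
    (A : subforest F) : Prop :=
  [/\ included (colour_class F i) A,
      forall j, i < j -> disjoint_sub (colour_class F j) A &
      forall j, 0 < j < i -> forall T, is_component (colour_class F j) T ->
        included T A \/ disjoint_sub T A].

Section ColourOps.
Context {L : finType}.

Lemma crestr_subproof (F : cforest L) (A : subforest F) (e : edge (restr A)) :
  ecol (val e) != 0 -> ncol (val (src e)) = ecol (val e) /\
                       ncol (val (tgt e)) = ecol (val e).
Proof. exact: col_edge. Qed.

Definition crestr (F : cforest L) (A : subforest F) : cforest L :=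
  @CForest L (restr A) (fun x => ncol (val x)) (fun e => ecol (val e))
    (@crestr_subproof F A).

Definition sum_ncol (F G : cforest L) (x : node (forest_sum F G)) : nat :=
  match x with inl x => ncol x | inr x => ncol x end.
Definition sum_ecol (F G : cforest L) (e : edge (forest_sum F G)) : nat :=
  match e with inl e => ecol e | inr e => ecol e end.

Lemma csum_subproof (F G : cforest L) (e : edge (forest_sum F G)) :
  sum_ecol e != 0 -> sum_ncol (src e) = sum_ecol e /\
                     sum_ncol (tgt e) = sum_ecol e.
Proof. by case: e => e; apply: col_edge. Qed.

Definition csum (F G : cforest L) : cforest L :=
  @CForest L (forest_sum F G) (@sum_ncol F G) (@sum_ecol F G)
    (@csum_subproof F G).

Lemma admissible_edge (i : nat) (F : cforest L) (A : subforest F) e :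
  admissible i A -> e \notin A.2 -> ecol e != 0 ->
  src e \notin A.1 /\ tgt e \notin A.1.
Proof.
case=> /andP[_ /fintype.subsetP iA] gA lA eA e0; have [cs ct] := col_edge e0.
have [ltj|gtj|eqj] := ltngtP (ecol e) i.
- pose T := component (colour_class F (ecol e)) (src e).
  have sT : src e \in T.1 by rewrite !inE cs eqxx connect0.
  have tT : tgt e \in T.1.
    rewrite !inE ct eqxx /=; apply: connect1; apply/existsP; exists e.
    by rewrite inE !eqxx.
  have eT : e \in T.2 by rewrite !inE eqxx connect0.
  have [||/andP[_ /fintype.subsetP/(_ _ eT)]|dT] := lA (ecol e) _ T.
  + by rewrite ltj lt0n e0.
  + by exists (src e) => //; rewrite inE cs.
  + by rewrite (negPf eA).
  + by rewrite !(disjointFr dT).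
- have dT := gA _ gtj.
  by rewrite !(disjointFr dT) // inE ?cs ?ct.
- by case/negP: eA; apply: iA; rewrite inE eqj.
Qed.

Definition cup_ncol (i : nat) (F : cforest L) (A : subforest F) (x : node F) :=
  if x \in A.1 then i else ncol x.
Definition cup_ecol (i : nat) (F : cforest L) (A : subforest F) (e : edge F) :=
  if e \in A.2 then i else ecol e.

Lemma cup_subproof (i : nat) (F : cforest L) (A : subforest F) :
  admissible i A -> forall e, cup_ecol i A e != 0 ->
  cup_ncol i A (src e) = cup_ecol i A e /\ cup_ncol i A (tgt e) = cup_ecol i A e.
Proof.
move=> adm e; rewrite /cup_ecol /cup_ncol; case: ifPn => [eA _|eA e0].
  by rewrite (sub_src eA) (sub_tgt eA).
have [/negPf-> /negPf->] := admissible_edge adm eA e0.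
exact: col_edge.
Qed.

(* The colouring denoted F-hat U_i A. *)
Definition cup (i : nat) (F : cforest L) (A : subforest F)
    (adm : admissible i A) : cforest L :=
  @CForest L F (cup_ncol i A) (cup_ecol i A) (cup_subproof adm).

End ColourOps.

Definition subforest_family (L : finType) : Type :=
  forall F : cforest L, {set subforest F}.

Definition assumption1 (L : finType) (i : nat) (AA : subforest_family L) : Prop :=
  (forall (F G : cforest L) (f : forest_iso F G), col_preserving f ->
     forall A : subforest F, (image_sub f A \in AA G) = (A \in AA F)) /\
  (forall (F : cforest L) (A : subforest F), A \in AA F -> admissible i A).

Definition subforest_family_adm (L : finType) (i : nat) (AA : subforest_family L)
    (A1 : assumption1 i AA) (F : cforest L) (A : subforest F)
    (hA : A \in AA F) : admissible i A := A1.2 F A hA.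

(* In the second item, [B \in AA (cup _)] makes sense only once [A \in AA F],
   which is what makes F-hat U_i A a colouring. *)
Definition assumption2 (L : finType) (i : nat) (AA : subforest_family L)
    (A1 : assumption1 i AA) : Prop :=
  (forall F G : cforest L,
     AA (csum F G) = [set subforest_sum C D | C in AA F, D in AA G]%SET) /\
  (forall (F : cforest L) (A B : subforest F),
     (exists hA : A \in AA F, B \in AA (cup (subforest_family_adm A1 hA))) <->
     [/\ B \in AA F, included A B & inside B A \in AA (crestr B)]).

(* A bigraded space given by a basis of homogeneous vectors. *)
Record bigraded : Type := Bigraded {
  basis :> choiceType;
  bideg : basis -> nat * nat }.

Arguments bideg {b}.

(* The element "sum_n v_n" is the function giving the coefficient of [v_n] on
   each basis vector of bidegree [n]. *)
Record series (R : realType) (X : bigraded) : Type := Series {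
  coef :> X -> R;
  series_fin : forall n, finite_set [set x | coef x != 0%R /\ bideg x = n];
  series_bound : exists k, forall x, coef x != 0%R -> (bideg x).2 <= k }.

Lemma series_eq (R : realType) (X : bigraded) (f g : series R X) :
  (forall x, f x = g x) -> f = g.
Proof.
case: f g => [f f1 f2] [g g1 g2] /= /funext fg.
by case: _ / fg in g1 g2 *; congr Series.
Qed.

(* Basis of the completed tensor product: the sum over [m + l = n] of the
   [V_m (x) W_l] has as basis the pairs of basis vectors of total bidegree
   [n]. *)
Definition tensor (X Y : bigraded) : bigraded :=
  @Bigraded (X * Y)%type
    (fun z => ((bideg z.1).1 + (bideg z.2).1, (bideg z.1).2 + (bideg z.2).2)).

(* A linear map given on the basis, mapping bidegree [n] into bidegrees [m]
   with [n.1 <= m.1] and [m.2 <= n.2]; such maps extend to formal series. *)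
Record bgmap (R : realType) (X Y : bigraded) : Type := BgMap {
  on_basis :> X -> series R Y;
  on_basisP : forall x y, on_basis x y != 0%R ->
    (bideg x).1 <= (bideg y).1 /\ (bideg y).2 <= (bideg x).2 }.

Section Series.
Local Open Scope classical_set_scope.
Context {R : realType}.

Lemma fsbig_neq0 (I : choiceType) (F : I -> R) :
  (\sum_(i \in [set: I]) F i)%R != 0%R -> exists i, F i != 0%R.
Proof.
move=> h; apply: contrapT => nex; case/eqP: h; apply: fsbig1 => i _.
by apply: contrapT => /eqP Fi; apply: nex; exists i.
Qed.

Definition extend_coef (X Y : bigraded) (phi : bgmap R X Y) (f : series R X)
    (y : Y) : R := (\sum_(x \in [set: X]) f x * phi x y)%R.

Lemma finite_degle (X : bigraded) (f : series R X) n :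
  finite_set [set x | f x != 0%R /\ (bideg x).1 <= n].
Proof.
have [k kP] := series_bound f.
apply: (@sub_finite_set _ _ (\bigcup_(a in `I_n.+1)
    \bigcup_(b in `I_k.+1) [set x | f x != 0%R /\ bideg x = (a, b)])).
  move=> x [fx xn]; exists (bideg x).1 => //=.
  by exists (bideg x).2; [apply: kP|split=> //; case: bideg].
apply: bigcup_finite => [|a _]; first exact: finite_II.
apply: bigcup_finite => [|b _]; first exact: finite_II.
exact: series_fin.
Qed.

(* The sum in [extend_coef] is finite. *)
Lemma extend_supp (X Y : bigraded) (phi : bgmap R X Y) (f : series R X) y :
  finite_set [set x | (f x * phi x y)%R != 0%R].
Proof.
apply: sub_finite_set (finite_degle f (bideg y).1) => x /=.
by rewrite mulf_eq0 negb_or => /andP[fx /on_basisP[]].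
Qed.

Lemma extend_fin (X Y : bigraded) (phi : bgmap R X Y) (f : series R X) n :
  finite_set [set y | extend_coef phi f y != 0%R /\ bideg y = n].
Proof.
apply: (@sub_finite_set _ _
    (\bigcup_(x in [set x | f x != 0%R /\ (bideg x).1 <= n.1])
       [set y | phi x y != 0%R /\ bideg y = n])).
  move=> y [/fsbig_neq0[x]]; rewrite mulf_eq0 negb_or => /andP[fx px] yn.
  by exists x => //; split=> //; rewrite -yn; case: (on_basisP px).
by apply: bigcup_finite => [|x _]; [apply: finite_degle|apply: series_fin].
Qed.

Lemma extend_bound (X Y : bigraded) (phi : bgmap R X Y) (f : series R X) :
  exists k, forall y, extend_coef phi f y != 0%R -> (bideg y).2 <= k.
Proof.
have [k kP] := series_bound f; exists k => y /fsbig_neq0[x].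
rewrite mulf_eq0 negb_or => /andP[/kP xk /on_basisP[_ yx]].
exact: leq_trans xk.
Qed.

Definition extend (X Y : bigraded) (phi : bgmap R X Y) (f : series R X) :
    series R Y := Series (extend_fin phi f) (extend_bound phi f).

Definition tens_coef (X Y : bigraded) (f : series R X) (g : series R Y)
    (z : tensor X Y) : R := (f z.1 * g z.2)%R.

Lemma tens_fin (X Y : bigraded) (f : series R X) (g : series R Y) n :
  finite_set [set z | tens_coef f g z != 0%R /\ bideg z = n].
Proof.
apply: (@sub_finite_set _ _ ([set x | f x != 0%R /\ (bideg x).1 <= n.1]
    `*` [set y | g y != 0%R /\ (bideg y).1 <= n.1])).
  move=> [x y] [/=]; rewrite /tens_coef mulf_eq0 negb_or => /andP[fx gy] <- /=.
  by split; split=> //=; [apply: leq_addr|apply: leq_addl].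
by apply: finite_setX; apply: finite_degle.
Qed.

Lemma tens_bound (X Y : bigraded) (f : series R X) (g : series R Y) :
  exists k, forall z, tens_coef f g z != 0%R -> (bideg z).2 <= k.
Proof.
have [k kP] := series_bound f; have [l lP] := series_bound g.
exists (k + l) => -[x y]; rewrite mulf_eq0 negb_or => /andP[/kP xk /lP yl].
exact: leq_add.
Qed.

Definition tens (X Y : bigraded) (f : series R X) (g : series R Y) :
    series R (tensor X Y) := Series (tens_fin f g) (tens_bound f g).

Definition delta_coef (X : bigraded) (x y : X) : R := (y == x)%:R%R.

Lemma delta_neq0 (X : bigraded) (x y : X) : delta_coef x y != 0%R -> y = x.
Proof. by rewrite /delta_coef; case: (y =P x) => //; rewrite eqxx. Qed.

Lemma delta_fin (X : bigraded) (x : X) n :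
  finite_set [set y | delta_coef x y != 0%R /\ bideg y = n].
Proof.
apply: sub_finite_set (finite_set1 x) => y [/delta_neq0 -> _].
by [].
Qed.

Lemma delta_bound (X : bigraded) (x : X) :
  exists k, forall y, delta_coef x y != 0%R -> (bideg y).2 <= k.
Proof. by exists (bideg x).2 => y /delta_neq0 ->. Qed.

Definition delta (X : bigraded) (x : X) : series R X :=
  Series (delta_fin x) (delta_bound x).

Lemma of_basis_subproof (X Y : bigraded) (h : X -> Y)
    (hP : forall x, bideg (h x) = bideg x) x y :
  delta (h x) y != 0%R ->
  (bideg x).1 <= (bideg y).1 /\ (bideg y).2 <= (bideg x).2.
Proof. by move=> /delta_neq0 ->; rewrite hP. Qed.

Definition of_basis (X Y : bigraded) (h : X -> Y)
    (hP : forall x, bideg (h x) = bideg x) : bgmap R X Y :=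
  BgMap (of_basis_subproof hP).

Definition bgid (X : bigraded) : bgmap R X X := of_basis (fun=> erefl).

Lemma map_tensor_subproof (X X' Y Y' : bigraded) (phi : bgmap R X X')
    (psi : bgmap R Y Y') (z : tensor X Y) (w : tensor X' Y') :
  tens (phi z.1) (psi z.2) w != 0%R ->
  (bideg z).1 <= (bideg w).1 /\ (bideg w).2 <= (bideg z).2.
Proof.
rewrite mulf_eq0 negb_or => /andP[/on_basisP[a b] /on_basisP[a' b']].
by split; apply: leq_add.
Qed.

Definition map_tensor (X X' Y Y' : bigraded) (phi : bgmap R X X')
    (psi : bgmap R Y Y') : bgmap R (tensor X Y) (tensor X' Y') :=
  BgMap (map_tensor_subproof (phi := phi) (psi := psi)).

Definition assoc_basis (X Y Z : bigraded) (w : tensor (tensor X Y) Z) :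
    tensor X (tensor Y Z) := (w.1.1, (w.1.2, w.2)).

Lemma assoc_basis_deg (X Y Z : bigraded) (w : tensor (tensor X Y) Z) :
  bideg (assoc_basis w) = bideg w.
Proof. by rewrite /= !addnA. Qed.

Definition bgassoc (X Y Z : bigraded) :
    bgmap R (tensor (tensor X Y) Z) (tensor X (tensor Y Z)) :=
  of_basis (@assoc_basis_deg X Y Z).

End Series.

Definition mindex (d : nat) : Type := {ffun 'I_d -> nat}.
HB.instance Definition _ d := GRing.Nmodule.on (mindex d).

(* [Z(L)], for [L] finite, is the group of integer valued functions on [L]. *)
Definition odecoration (d : nat) (L : finType) : Type :=
  ({ffun 'I_d -> int} * {ffun L -> int})%type.
HB.instance Definition _ d L := GRing.Zmodule.on (odecoration d L).

Definition to_int (d : nat) (m : mindex d) : {ffun 'I_d -> int} :=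
  [ffun j => Posz (m j)].

Definition to_odec (d : nat) (L : finType) (v : {ffun 'I_d -> int}) :
    odecoration d L := (v, 0%R).

Definition msize (d : nat) (m : mindex d) : nat := \sum_j m j.

Record dforest (d : nat) (L : finType) : Type := DForest {
  dforest_cforest :> cforest L;
  ndec : node dforest_cforest -> mindex d;
  odec : node dforest_cforest -> odecoration d L;
  edec : edge dforest_cforest -> mindex d;
  odec_col : forall x, ncol x = 0 -> odec x = 0%R;
  edec_col : forall e, ecol e != 0 -> edec e = 0%R }.

Arguments ndec {d L} {_}.
Arguments odec {d L} {_}.
Arguments edec {d L} {_}.

HB.instance Definition _ d L := gen_eqMixin (dforest d L).
HB.instance Definition _ d L := gen_choiceMixin (dforest d L).

Section DecoratedForests.
Context {d : nat} {L : finType}.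
Implicit Types t u v : dforest d L.

Definition dforest_isomorphic t u : Prop :=
  exists f : forest_iso t u,
    [/\ col_preserving f,
        forall x, ndec (iso_node f x) = ndec x,
        forall x, odec (iso_node f x) = odec x &
        forall e, edec (iso_edge f e) = edec e].

Definition isob : rel (dforest d L) := fun t u => `[< dforest_isomorphic t u >].

Lemma isob_refl : reflexive isob.
Proof. by move=> t; apply/asboolP; exists (iso_id t). Qed.

Lemma isob_impl t u : isob t u -> isob u t.
Proof.
move=> /asboolP[f [[c1 c2] n o e]]; apply/asboolP.
have [g [_ [_ [K1 K2]]]] := iso_inverse f; exists g.
split; [split=> x|move=> x..].
- by rewrite -c1 K1.
- by rewrite -c2 K2.
- by rewrite -n K1.
- by rewrite -o K1.
- by rewrite -e K2.
Qed.

Lemma isob_sym : symmetric isob.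
Proof. by move=> t u; apply/idP/idP; apply: isob_impl. Qed.

Lemma isob_trans : transitive isob.
Proof.
move=> u t v /asboolP[f [[c1 c2] n o e]] /asboolP[g [[c1' c2'] n' o' e']].
apply/asboolP; exists (iso_comp f g); split; [split=> x|move=> x..] => /=.
- by rewrite c1' c1.
- by rewrite c2' c2.
- by rewrite n' n.
- by rewrite o' o.
- by rewrite e' e.
Qed.

Canonical isob_equiv : equiv_rel (dforest d L) :=
  EquivRel isob isob_refl isob_sym isob_trans.

End DecoratedForests.

Definition dforest_class (d : nat) (L : finType) : Type :=
  {eq_quot @isob_equiv d L}%qT.
HB.instance Definition _ d L := Choice.on (dforest_class d L).
HB.instance Definition _ d L := Quotient.on (dforest_class d L).
HB.instance Definition _ d L := EqQuotient.on (dforest_class d L).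

Section Bidegree.
Context {d : nat} {L : finType}.
Implicit Types t u : dforest d L.

Definition dforest_bideg t : nat * nat :=
  (\sum_(e : edge t) msize (edec e),
   #|[set x : node t | (ncol x == 0) && ~~ is_root x]|
     + #|[set e : edge t | ecol e == 0]|).

Lemma card_set_bij (T U : finType) (f : T -> U) (P : pred T) (Q : pred U) :
  bijective f -> (forall x, Q (f x) = P x) ->
  #|[set y | Q y]| = #|[set x | P x]|.
Proof.
move=> bf PQ; rewrite -(card_imset [set x | P x] (bij_inj bf)).
apply: eq_card => y; rewrite inE; have [g fK gK] := bf.
apply/idP/imsetP => [Qy|[x Px ->]]; last by rewrite PQ; rewrite inE in Px.
by exists (g y); rewrite ?gK // inE -PQ gK.
Qed.

Lemma is_root_iso (F G : forest L) (f : forest_iso F G) x :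
  is_root (iso_node f x) = is_root x.
Proof.
have [g eK gK] := iso_edge_bij f; apply/forallP/forallP => h e.
  by apply: contraNneq (h (iso_edge f e)) => <-; rewrite iso_tgt.
rewrite -(gK e) iso_tgt (inj_eq (bij_inj (iso_node_bij f))); exact: h.
Qed.

Lemma dforest_bideg_iso t u :
  dforest_isomorphic t u -> dforest_bideg t = dforest_bideg u.
Proof.
case=> f [[c1 c2] _ _ e]; rewrite /dforest_bideg; congr (_, _).
  have [g eK gK] := iso_edge_bij f.
  rewrite (reindex (iso_edge f)) /=; last by exists g => ? _.
  by apply: eq_bigr => x _; rewrite e.
congr addn; apply/esym.
  by apply: card_set_bij (iso_node_bij f) _ => x; rewrite c1 is_root_iso.
by apply: card_set_bij (iso_edge_bij f) _ => x; rewrite c2.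
Qed.

Definition class_bideg (c : dforest_class d L) : nat * nat :=
  dforest_bideg (repr c).

Lemma class_bideg_pi t :
  class_bideg (\pi_(dforest_class d L) t)%qT = dforest_bideg t.
Proof.
apply: dforest_bideg_iso; apply/asboolP.
by have /eqmodP := reprK (\pi_(dforest_class d L) t)%qT; apply.
Qed.

End Bidegree.

Definition FF (d : nat) (L : finType) : bigraded :=
  @Bigraded (dforest_class d L) class_bideg.

Section Product.
Context {d : nat} {L : finType}.
Implicit Types t u : dforest d L.

Definition dsum_ndec t u (x : node (csum t u)) : mindex d :=
  match x with inl x => ndec x | inr x => ndec x end.
Definition dsum_odec t u (x : node (csum t u)) : odecoration d L :=
  match x with inl x => odec x | inr x => odec x end.
Definition dsum_edec t u (e : edge (csum t u)) : mindex d :=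
  match e with inl e => edec e | inr e => edec e end.

Lemma dsum_odec_col t u x : @ncol L (csum t u) x = 0 -> dsum_odec x = 0%R.
Proof. by case: x => x; apply: odec_col. Qed.

Lemma dsum_edec_col t u e : @ecol L (csum t u) e != 0 -> dsum_edec e = 0%R.
Proof. by case: e => e; apply: edec_col. Qed.

Definition dsum t u : dforest d L :=
  @DForest d L (csum t u) (@dsum_ndec t u) (@dsum_odec t u) (@dsum_edec t u)
    (@dsum_odec_col t u) (@dsum_edec_col t u).

Lemma card_set_sum (T U : finType) (P : pred (T + U)) :
  #|[set z | P z]| = #|[set x | P (inl x)]| + #|[set y | P (inr y)]|.
Proof.
rewrite -!sum1_card big_sumType /=.
by congr addn; apply: eq_bigl => x; rewrite !inE.
Qed.

Lemma dsum_bideg t u :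
  dforest_bideg (dsum t u) =
  ((dforest_bideg t).1 + (dforest_bideg u).1,
   (dforest_bideg t).2 + (dforest_bideg u).2).
Proof.
rewrite /dforest_bideg; congr (_, _).
  exact: (@big_sumType _ _ _ (edge t) (edge u) xpredT).
rewrite [RHS]addnACA; congr addn.
  rewrite (@card_set_sum (node t) (node u)).
  congr addn; apply: eq_card => x; rewrite !inE; congr (_ && ~~ _).
    apply/forallP/forallP => h e; first exact: (h (inl e)).
    by case: e => e //; apply: h.
  apply/forallP/forallP => h e; first exact: (h (inr e)).
  by case: e => e //; apply: h.
by rewrite (@card_set_sum (edge t) (edge u)).
Qed.

Definition prod_basis (z : tensor (FF d L) (FF d L)) : FF d L :=
  (\pi_(dforest_class d L) (dsum (repr z.1) (repr z.2)))%qT.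

Lemma prod_basis_deg z : bideg (prod_basis z) = bideg z.
Proof. by rewrite /= class_bideg_pi dsum_bideg. Qed.

Definition prod2_basis
    (z : tensor (tensor (FF d L) (FF d L)) (tensor (FF d L) (FF d L))) :
    tensor (FF d L) (FF d L) :=
  (prod_basis (z.1.1, z.2.1), prod_basis (z.1.2, z.2.2)).

Lemma prod2_basis_deg z : bideg (prod2_basis z) = bideg z.
Proof.
case: z => [[a b] [a' b']].
transitivity ((bideg (prod_basis (a, a'))).1 + (bideg (prod_basis (b, b'))).1,
  (bideg (prod_basis (a, a'))).2 + (bideg (prod_basis (b, b'))).2) => //.
by rewrite !prod_basis_deg /=; congr (_, _); rewrite addnACA.
Qed.

End Product.

Definition forest_prod (R : realType) (d : nat) (L : finType)
    (f g : series R (FF d L)) : series R (FF d L) :=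
  extend (of_basis prod_basis_deg) (tens f g).

(* (a (x) b) . (a' (x) b') = (a . a') (x) (b . b') *)
Definition forest_prod2 (R : realType) (d : nat) (L : finType)
    (f g : series R (tensor (FF d L) (FF d L))) :
    series R (tensor (FF d L) (FF d L)) :=
  extend (of_basis prod2_basis_deg) (tens f g).

Section Coproduct.
Context {d : nat} {L : finType} {i : nat} {AA : subforest_family L}.
Hypotheses (i_gt0 : 0 < i) (A1 : assumption1 i AA).
Implicit Types t : dforest d L.
Local Open Scope ring_scope.

Section Terms.
Context (t : dforest d L).

Definition cut_data : choiceType :=
  (subforest t * {ffun edge t -> mindex d} * {ffun node t -> mindex d})%type.

(* [z] is a triple (A, epsilon, n_A) over which the sum ranges. *)
Definition is_cut (z : cut_data) : bool :=
  let: (A, eps, nA) := z in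
  [&& A \in AA t,
      [forall e, (eps e != 0) ==> (e \notin A.2) && (src e \in A.1)] &
      [forall x, (nA x != 0) ==> (x \in A.1)]].

Definition cut : choiceType := {z : cut_data | is_cut z}.

Definition cut_sub (z : cut) : subforest t := (val z).1.1.
Definition cut_eps (z : cut) : {ffun edge t -> mindex d} := (val z).1.2.
Definition cut_n (z : cut) : {ffun node t -> mindex d} := (val z).2.

Lemma cut_subP z : cut_sub z \in AA t.
Proof. by rewrite /cut_sub; case: z => -[[A e] n] /= /and3P[]. Qed.

Lemma cut_adm z : admissible i (cut_sub z).
Proof. exact: subforest_family_adm A1 _ _ (cut_subP z). Qed.

Lemma cut_epsP z e : cut_eps z e != 0 ->
  (e \notin (cut_sub z).2) && (src e \in (cut_sub z).1).
Proof.
rewrite /cut_eps /cut_sub; case: z => -[[A eps] n] /= /and3P[_ /forallP h _].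
exact/implyP.
Qed.

Lemma cut_nP z x : cut_n z x != 0 -> x \in (cut_sub z).1.
Proof.
rewrite /cut_n /cut_sub; case: z => -[[A eps] n] /= /and3P[_ _ /forallP h].
exact/implyP.
Qed.

Definition cut_coef (R : realType) (z : cut) : R :=
  (\prod_x \prod_j 'C(ndec x j, cut_n z x j))%N%:R /
  (\prod_e \prod_j (cut_eps z e j)`!)%N%:R.

Section LeftTerm.
Variable z : cut.

Definition left_ndec (x : node (crestr (cut_sub z))) : mindex d :=
  cut_n z (val x) + \sum_(e | src e == val x) cut_eps z e.
Definition left_odec (x : node (crestr (cut_sub z))) : odecoration d L :=
  odec (val x).
Definition left_edec (e : edge (crestr (cut_sub z))) : mindex d :=
  edec (val e).

Lemma left_odec_col x : ncol x = 0%N -> left_odec x = 0.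
Proof. exact: odec_col. Qed.

Lemma left_edec_col e : ecol e != 0%N -> left_edec e = 0.
Proof. exact: edec_col. Qed.

Definition left_term : dforest d L :=
  @DForest d L (crestr (cut_sub z)) left_ndec left_odec left_edec
    left_odec_col left_edec_col.

Definition right_ndec (x : node t) : mindex d :=
  [ffun j => (ndec x j - cut_n z x j)%N].
Definition right_odec (x : node t) : odecoration d L :=
  odec x + to_odec L (to_int (cut_n z x) +
    \sum_(e | src e == x)
      (to_int (cut_eps z e) -
       (if e \in (cut_sub z).2 then to_int (edec e) else 0))).
Definition right_edec (e : edge t) : mindex d :=
  (if e \in (cut_sub z).2 then 0 else edec e) + cut_eps z e.

Lemma right_odec_col (x : node (cup (cut_adm z))) :
  ncol x = 0%N -> right_odec x = 0.
Proof.
rewrite /= /cup_ncol /right_odec; case: ifPn => [_ i0|xA x0].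
  by move: i_gt0; rewrite i0.
have to0 : to_int (0 : mindex d) = 0 by apply/ffunP => j; rewrite !ffunE.
rewrite odec_col // add0r (_ : cut_n z x = 0); last first.
  by apply: contraNeq xA; apply: cut_nP.
rewrite to0 add0r big1 // => e /eqP se.
rewrite (_ : cut_eps z e = 0); last first.
  by apply: contraNeq xA => /cut_epsP/andP[_]; rewrite se.
rewrite ifN ?to0 ?subrr //; apply: contra xA => /sub_src.
by rewrite se.
Qed.

Lemma right_edec_col (e : edge (cup (cut_adm z))) :
  ecol e != 0%N -> right_edec e = 0.
Proof.
rewrite /= /cup_ecol /right_edec; case: ifPn => [eA _|eA e0].
  rewrite add0r; apply: contraTeq eA => /cut_epsP/andP[].
  by [].
rewrite edec_col // add0r; apply/eqP; apply: contraT => /cut_epsP/andP[_].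
by case: (admissible_edge (cut_adm z) eA e0) => /negPf->.
Qed.

Definition right_term : dforest d L :=
  @DForest d L (cup (cut_adm z)) right_ndec right_odec right_edec
    right_odec_col right_edec_col.

Definition cut_term : tensor (FF d L) (FF d L) :=
  ((\pi_(dforest_class d L) left_term)%qT,
   (\pi_(dforest_class d L) right_term)%qT).

End LeftTerm.

Definition Delta_dforest (R : realType) (y : tensor (FF d L) (FF d L)) : R :=
  \sum_(z \in [set: cut]%classic) cut_coef R z * (cut_term z == y)%:R.

Lemma msizeD (m n : mindex d) : msize (m + n) = (msize m + msize n)%N.
Proof. by rewrite /msize -big_split; apply: eq_bigr => j _; rewrite ffunE. Qed.

Lemma cut_term_bideg z : bideg (cut_term z) =
  (((dforest_bideg (left_term z)).1 + (dforest_bideg (right_term z)).1)%N,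
   ((dforest_bideg (left_term z)).2 + (dforest_bideg (right_term z)).2)%N).
Proof.
by rewrite -(class_bideg_pi (left_term z)) -(class_bideg_pi (right_term z)).
Qed.

Lemma cut_term_deg1 z : (bideg (cut_term z)).1 =
  ((dforest_bideg t).1 + \sum_e msize (cut_eps z e))%N.
Proof.
rewrite cut_term_bideg /=.
have -> : \sum_(e : edge t) msize (right_edec z e) =
    (\sum_(e | e \notin (cut_sub z).2) msize (edec e) +
     \sum_e msize (cut_eps z e))%N.
  rewrite [X in (X + _)%N]big_mkcond -big_split; apply: eq_bigr => e _ /=.
  rewrite msizeD; case: ifP => _ //=.
  by rewrite [msize 0]/msize big1 // => j _; rewrite ffunE.
rewrite addnA; congr addn; rewrite [RHS](bigID (mem (cut_sub z).2)) /=.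
congr addn; apply/esym.
exact: (@big_sub _ _ _ (edge t) (mem (cut_sub z).2) (fun e => msize (edec e))).
Qed.

Lemma card_left (T : smallFinType) (A : {set T}) (P : pred T) :
  #|[set x : small_sub A | P (val x)]| = #|[set x in A | P x]|.
Proof.
rewrite -(@card_imset (small_sub A) T val _ val_inj); apply: eq_card => x; rewrite inE.
apply/imsetP/andP => [[y]|[xA Px]].
  by rewrite inE => Py ->; split=> //; apply: valP.
by exists (Sub x xA) => //; rewrite inE.
Qed.

Lemma card_left_le (T : smallFinType) (A : {set T}) (P : pred (small_sub A))
    (Q : pred T) : (forall x, P x -> Q (val x)) ->
  (#|[set x | P x]| <= #|[set x in A | Q x]|)%N.
Proof.
move=> PQ; rewrite -card_left; apply: subset_leq_card.
by apply/fintype.subsetP => x; rewrite !inE; apply: PQ.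
Qed.

Lemma card_two (T : finType) (A : {set T}) (P Q : pred T) n :
  (n <= #|[set x in A | P x]|)%N ->
  (forall x, Q x -> (x \notin A) && P x) ->
  (n + #|[set x | Q x]| <= #|[set x | P x]|)%N.
Proof.
move=> nA QP; rewrite -(cardsID A [set x | P x]); apply: leq_add.
  by apply: leq_trans nA _; apply: subset_leq_card;
    apply/fintype.subsetP => x; rewrite !inE andbC.
by apply: subset_leq_card; apply/fintype.subsetP => x; rewrite !inE; apply: QP.
Qed.

Lemma cut_term_deg2 z : ((bideg (cut_term z)).2 <= (dforest_bideg t).2)%N.
Proof.
rewrite cut_term_bideg /= addnACA; apply: leq_add.
  apply: card_two => [|x].
    apply: card_left_le => x /andP[-> /=]; apply: contra => /forallP rx.
    by apply/forallP => e; apply: contra (rx (val e)) => /eqP <-.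
  rewrite /cup_ncol; case: ifP => _ //.
  by rewrite (gtn_eqF i_gt0).
apply: card_two => [|e]; first exact: card_left_le.
by rewrite /cup_ecol; case: ifP => _ //; rewrite (gtn_eqF i_gt0).
Qed.

Lemma cut_coef_le (R : realType) z :
  cut_coef R z != 0 -> forall x j, (cut_n z x j <= ndec x j)%N.
Proof.
rewrite mulf_eq0 negb_or pnatr_eq0 => /andP[+ _] x j; rewrite -lt0n.
by rewrite (bigD1 x) //= muln_gt0 (bigD1 j) //= muln_gt0 bin_gt0 => /andP[/andP[]].
Qed.

Lemma finite_cuts (R : realType) n : finite_set
  [set z : cut | cut_coef R z != 0 /\ (\sum_e msize (cut_eps z e) <= n)%N]%classic.
Proof.
pose K := (n + \sum_(x : node t) msize (ndec x))%N.
pose I := (subforest t * {ffun edge t -> {ffun 'I_d -> 'I_K.+1}} *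
           {ffun node t -> {ffun 'I_d -> 'I_K.+1}})%type.
pose g (w : I) : cut_data :=
  (w.1.1, [ffun e => [ffun j => w.1.2 e j : nat] : mindex d],
          [ffun x => [ffun j => w.2 x j : nat] : mindex d]).
have fg : finite_set (g @` [set: I])%classic.
  by apply: finite_image; apply: finite_finset.
have := finite_preimage (f := (val : cut -> cut_data)) _ fg.
move=> /(_ (fun x y _ _ => @val_inj _ _ _ x y)); apply: sub_finite_set => z [].
move=> /cut_coef_le zn ze.
have le1 (T : finType) (F : T -> mindex d) x j : (F x j <= \sum_x msize (F x))%N.
  by rewrite (bigD1 x) // /msize (bigD1 j) //= -!addnA leq_addr.
exists (cut_sub z, [ffun e => [ffun j => inord (cut_eps z e j)]],
        [ffun x => [ffun j => inord (cut_n z x j)]]) => //.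
rewrite /g /= [RHS]surjective_pairing [X in _ = (X, _)]surjective_pairing.
congr (_, _, _); apply/ffunP => x; apply/ffunP => j; rewrite !ffunE.
  rewrite inordK // ltnS; apply: leq_trans (leq_addr _ _).
  by apply: leq_trans ze; apply: le1.
rewrite inordK // ltnS; apply: leq_trans (leq_addl _ _).
by apply: leq_trans (zn x j) _; apply: le1.
Qed.

Lemma Delta_neq0 (R : realType) y : Delta_dforest R y != 0 ->
  exists2 z, cut_coef R z != 0 & cut_term z = y.
Proof.
move=> /fsbig_neq0[z]; rewrite mulf_eq0 negb_or => /andP[cz].
by case: (cut_term z =P y) => [<- _|_]; [exists z|rewrite eqxx].
Qed.

(* The sum in [Delta_dforest] is finite. *)
Lemma Delta_supp (R : realType) y : finite_set
  [set z | cut_coef R z * (cut_term z == y)%:R != 0]%classic.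
Proof.
apply: sub_finite_set (finite_cuts R (bideg y).1) => z.
rewrite [X in X -> _]/= mulf_eq0 negb_or => /andP[cz].
case: (cut_term z =P y) => [<- _|_]; last by rewrite eqxx.
by split=> //; rewrite cut_term_deg1 leq_addl.
Qed.

Lemma Delta_fin (R : realType) n : finite_set
  [set y | Delta_dforest R y != 0 /\ bideg y = n]%classic.
Proof.
apply: sub_finite_set (finite_image cut_term (finite_cuts R n.1)).
move=> y [/Delta_neq0[z cz <-] zn]; exists z => //; split=> //.
by rewrite -zn cut_term_deg1 leq_addl.
Qed.

Lemma Delta_bound (R : realType) : exists k, forall y,
  Delta_dforest R y != 0 -> ((bideg y).2 <= k)%N.
Proof.
exists (dforest_bideg t).2 => y /Delta_neq0[z _ <-].
exact: cut_term_deg2.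
Qed.

Definition Delta_series (R : realType) : series R (tensor (FF d L) (FF d L)) :=
  Series (@Delta_fin R) (@Delta_bound R).

End Terms.

Lemma Delta_triangular (R : realType) (c : FF d L) y :
  Delta_series (repr c) R y != 0 ->
  ((bideg c).1 <= (bideg y).1)%N /\ ((bideg y).2 <= (bideg c).2)%N.
Proof.
move=> /Delta_neq0[z _ <-].
by split; [rewrite cut_term_deg1 leq_addr|apply: cut_term_deg2].
Qed.

(* Independent of the choice of [repr], by the first item of [assumption1]. *)
Definition Delta_map (R : realType) :
    bgmap R (FF d L) (tensor (FF d L) (FF d L)) :=
  BgMap (@Delta_triangular R).

End Coproduct.

Definition Delta (R : realType) (d : nat) (L : finType) (i : nat)
    (AA : subforest_family L) (i_gt0 : 0 < i) (A1 : assumption1 i AA)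
    (f : series R (FF d L)) : series R (tensor (FF d L) (FF d L)) :=
  extend (Delta_map i_gt0 A1 R) f.

Definition Delta_id (R : realType) (d : nat) (L : finType) (i : nat)
    (AA : subforest_family L) (i_gt0 : 0 < i) (A1 : assumption1 i AA)
    (f : series R (tensor (FF d L) (FF d L))) :
    series R (tensor (tensor (FF d L) (FF d L)) (FF d L)) :=
  extend (map_tensor (Delta_map i_gt0 A1 R) (bgid (FF d L))) f.

Definition id_Delta (R : realType) (d : nat) (L : finType) (i : nat)
    (AA : subforest_family L) (i_gt0 : 0 < i) (A1 : assumption1 i AA)
    (f : series R (tensor (FF d L) (FF d L))) :
    series R (tensor (FF d L) (tensor (FF d L) (FF d L))) :=
  extend (map_tensor (bgid (FF d L)) (Delta_map i_gt0 A1 R)) f.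

(* Main.v *)
Require Import Defs.
From HB Require Import structures.
From mathcomp Require Import all_boot all_order all_algebra.
From mathcomp Require Import all_classical all_reals.

(* Both identities are checked on a forest t, and all the sums involved have
   finitely many non-zero terms at each basis vector of the target.

   For coassociativity, write pi h (x) for the sum of h over the edges leaving
   x.  A term on the left is given by (B, eps_B, n_B), a cut of t, followed by
   (A, eps_A, n_A), a cut of B, and a term on the right by a cut (A, eps'_A,
   n'_A) of t followed by a cut (B, eps'_B, n'_B) of F-hat U_i A.  By the second
   item of assumption 2 the pairs A, B are the same on both sides.  If h is the
   part of eps'_A carried by the edges outside B, then
     eps'_A = eps_A + h,            eps_B = h + eps'_B,
     n_A = n'_A + pi h,             n_B = n'_A + n'_B
   attaches to a right term a left term with the same three tensor factors, and
   a right term is recovered from its left term and h.  It remains to sum the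
   coefficients over h, which is the Vandermonde identity
     sum_h C(n_B, n_A - pi h) C(eps_B, h) = C(n_B + pi eps_B, n_A).

   For multiplicativity, the first item of assumption 2 turns a pair of cuts of
   t and u into a cut of their disjoint union, bijectively. *)

Set Implicit Arguments.
Unset Strict Implicit.
Unset Printing Implicit Defensive.

Import Order.TTheory GRing.Theory Num.Theory.

(** * Finitely supported sums and maps of bigraded spaces *)


Section FiniteSums.
Local Open Scope classical_set_scope.
Local Open Scope ring_scope.
Context {R : realType}.

(** Surjectivity is asked onto the support only: the correspondences used later reach just the terms
    with a non-zero coefficient. *)
Lemma fsum_reindex (I J : choiceType) (h : I -> J) (F : J -> R) :
  injective h -> (forall j, F j != 0 -> exists i, h i = j) ->
  \sum_(j \in [set: J]) F j = \sum_(i \in [set: I]) F (h i).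
Proof.
move=> h_inj h_surj; transitivity (\sum_(j \in h @` setT) F j); last first.
  by apply: fsbig_image; apply: in2W.
apply: esym; apply: fsbig_widen => // j [_ /= nj];
  apply: contrapT => /eqP/h_surj[i hi].
by apply: nj; exists i.
Qed.

Lemma fsum_restrict (I : choiceType) (F : I -> R) (S : set I) :
  (forall i, F i != 0 -> S i) ->
  \sum_(i \in [set: I]) F i = \sum_(i \in S) F i.
Proof.
move=> FS; apply: esym; apply: fsbig_widen => // i [_ /= nSi]; apply: contrapT.
by move=> /eqP/FS.
Qed.

Lemma fsum_single (I : choiceType) (F : I -> R) a :
  (forall i, F i != 0 -> i = a) -> \sum_(i \in [set: I]) F i = F a.
Proof.
move=> Fa; rewrite (@fsum_restrict _ _ [set a]) ?fsbig_set1 //.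
Qed.

(** A sum of infinite support has the value 0 by convention, so it is finite support that allows the
    exchange; both sums are first cut down to the support and its image. *)
Lemma fsum_fiber (K I : choiceType) (f : K -> I) (F : K -> R) :
  finite_set [set k | F k != 0] ->
  \sum_(k \in [set: K]) F k =
  \sum_(i \in [set: I]) \sum_(k \in [set: K]) (if f k == i then F k else 0).
Proof.
move=> finF; set S := [set k | F k != 0] in finF *.
rewrite (@fsum_restrict _ _ S) //.
rewrite (@fsum_restrict _ _ (f @` S)); last first.
  move=> i /fsbig_neq0[k]; case: (f k =P i) => [<- Fk|]; last by rewrite eqxx.
  by exists k.
under [RHS]eq_fsbigr => i _.
  rewrite (@fsum_restrict _ _ S); last by move=> k; case: (f k == i) => //;
    rewrite eqxx.
  over.
rewrite exchange_fsbig //; last exact: finite_image.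
apply: eq_fsbigr => k kS; rewrite (fsbig_widen _ [set: I]) //; last first.
  move=> i [_ /= ni]; case: (f k =P i) => // fk; case: ni; exists k => //.
  by rewrite inE in kS.
by rewrite (@fsum_single _ _ (f k)) ?eqxx // => i; case: (f k =P i) => // _;
  rewrite eqxx.
Qed.

(** Serves for iterated cuts, where the type of the second cut depends on the first. *)
Lemma fsum_sigma (I : choiceType) (T : I -> choiceType) (F : {i : I & T i} -> R) :
  finite_set [set p | F p != 0] ->
  \sum_(p \in [set: {i : I & T i}]) F p =
  \sum_(i \in [set: I]) \sum_(x \in [set: T i]) F (Tagged T x).
Proof.
move=> finF; rewrite (fsum_fiber tag finF); apply: eq_fsbigr => i _.
rewrite (@fsum_reindex _ _ (fun x : T i => Tagged T x)).
- by apply: eq_fsbigr => x _; rewrite /= eqxx.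
- by move=> x y /eqP; rewrite -tag_eqE /tag_eq /= eqxx /= tagged_asE => /eqP.
- by move=> [j x] /=; case: (j =P i) => [ji _|]; [case: _ / ji;
    exists x|rewrite eqxx].
Qed.

Lemma fsum_pair (I J : choiceType) (F : I * J -> R) :
  finite_set [set p | F p != 0] ->
  \sum_(p \in [set: (I * J)%type]) F p =
  \sum_(i \in [set: I]) \sum_(j \in [set: J]) F (i, j).
Proof.
move=> finF; rewrite (fsum_fiber fst finF); apply: eq_fsbigr => i _.
rewrite (@fsum_reindex _ _ (pair i)).
- by apply: eq_fsbigr => x _; rewrite /= eqxx.
- by move=> x y [].
- by move=> [j x] /=; case: (j =P i) => [-> _|]; [exists x|rewrite eqxx].
Qed.

Lemma fsum_exchange (I J : choiceType) (F : I -> J -> R) :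
  finite_set [set p : I * J | F p.1 p.2 != 0] ->
  \sum_(i \in [set: I]) \sum_(j \in [set: J]) F i j =
  \sum_(j \in [set: J]) \sum_(i \in [set: I]) F i j.
Proof.
move=> finF; rewrite -(fsum_pair finF).
rewrite (@fsum_reindex _ _ (fun p : J * I => (p.2, p.1))).
- rewrite fsum_pair //=.
  rewrite (_ : [set p | _] = (fun p : I * J => (p.2, p.1)) @`
     [set p : I * J | F p.1 p.2 != 0]); first exact: finite_image.
  by apply/seteqP; split=> [[j i] /= Fp|_ [[i j] /= Fp <-]] //; exists (i, j).
- by move=> [a b] [c e] [-> ->].
- by move=> [a b] _; exists (b, a).
Qed.

Lemma finite_sigma (I : choiceType) (T : I -> choiceType) (S : set I)
    (U : forall i, set (T i)) :
  finite_set S -> (forall i, S i -> finite_set (U i)) ->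
  finite_set [set p : {i : I & T i} | S (tag p) /\ U (tag p) (tagged p)].
Proof.
move=> finS finU.
apply: (@sub_finite_set _ _ (\bigcup_(i in S) ((fun x : T i => Tagged T x) @` U i))).
  by move=> [i x] /= [Si Ui]; exists i => //; exists x.
by apply: bigcup_finite => // i Si; apply: finite_image; apply: finU.
Qed.

End FiniteSums.

(** * Composition and tensor products of maps of bigraded spaces *)

Section BigradedMaps.
Local Open Scope classical_set_scope.
Local Open Scope ring_scope.
Context {R : realType}.
Implicit Types X Y Z : bigraded.

Lemma bgcomp_subproof X Y Z (phi : bgmap R X Y) (psi : bgmap R Y Z) x z :
  extend psi (phi x) z != 0 ->
  ((bideg x).1 <= (bideg z).1)%N /\ ((bideg z).2 <= (bideg x).2)%N.
Proof.
move=> /fsbig_neq0[y]; rewrite mulf_eq0 negb_or.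
move=> /andP[/on_basisP[a b] /on_basisP[a' b']].
by split; [apply: leq_trans a'|apply: leq_trans b].
Qed.

Definition bgcomp X Y Z (phi : bgmap R X Y) (psi : bgmap R Y Z) : bgmap R X Z :=
  BgMap (bgcomp_subproof (phi := phi) (psi := psi)).

(** The double sum over [x] and [y] is finite because the first degree cannot decrease along
    non-zero terms: [(bideg z).1] bounds those of [x] and [y]. With [eq_extend], identities between
    composites reduce to basis vectors. *)
Lemma extend_comp X Y Z (phi : bgmap R X Y) (psi : bgmap R Y Z) (f : series R X) :
  extend psi (extend phi f) = extend (bgcomp phi psi) f.
Proof.
apply: series_eq => z; rewrite /= /extend_coef /=.
under eq_fsbigr => y _ do rewrite mulr_fsuml.
rewrite -fsum_exchange.
  apply: eq_fsbigr => x _; rewrite /extend_coef mulr_fsumr.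
  by apply: eq_fsbigr => y _; rewrite mulrA.
pose S := [set x | f x != 0 /\ ((bideg x).1 <= (bideg z).1)%N].
pose U x := [set y | phi x y != 0 /\ ((bideg y).1 <= (bideg z).1)%N].
apply: (@sub_finite_set _ _ (\bigcup_(x in S) (pair x @` U x))); last first.
  apply: bigcup_finite => [|x _]; first exact: finite_degle.
  by apply: finite_image; apply: finite_degle.
move=> [x y] /=; rewrite !mulf_eq0 !negb_or =>
  /andP[/andP[fx py] /on_basisP[yz _]].
have [xy _] := on_basisP py.
by exists x; [split=> //; apply: leq_trans yz|exists y].
Qed.

Lemma eq_extend X Y (phi psi : bgmap R X Y) (f : series R X) :
  (forall x y, phi x y = psi x y) -> extend phi f = extend psi f.
Proof.
by move=> e; apply: series_eq => y; apply: eq_fsbigr => x _; rewrite e.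
Qed.

Lemma tens_extend X X' Y Y' (phi : bgmap R X X') (psi : bgmap R Y Y')
    (f : series R X) (g : series R Y) :
  tens (extend phi f) (extend psi g) = extend (map_tensor phi psi) (tens f g).
Proof.
apply: series_eq => -[x' y']; rewrite /= /tens_coef /= /extend_coef.
rewrite (@fsum_pair _ _ _
  (fun z : X * Y => tens f g z * map_tensor phi psi z (x', y'))).
  rewrite mulr_fsuml; apply: eq_fsbigr => x _; rewrite mulr_fsumr.
  by apply: eq_fsbigr => y _; rewrite /= /tens_coef /= mulrACA.
exact: (@extend_supp _ (tensor X Y) (tensor X' Y')).
Qed.

Lemma extend_of_basis X Y (h : X -> Y) hP (f : series R X) y :
  extend (@of_basis R X Y h hP) f y =
  \sum_(x \in [set: X]) f x * (y == h x)%:R.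
Proof. by []. Qed.

Lemma extend_assoc X Y Z (f : series R (tensor (tensor X Y) Z)) a b c :
  extend (bgassoc X Y Z) f (a, (b, c)) = f ((a, b), c).
Proof.
rewrite extend_of_basis (@fsum_single _ _ _ ((a, b), c)) ?eqxx ?mulr1 //.
move=> [[a' b'] c']; rewrite mulf_eq0 negb_or => /andP[_].
by case: (_ =P assoc_basis _) => [[-> -> ->]|]; rewrite ?eqxx.
Qed.

End BigradedMaps.

(** * Isomorphism classes and transport of cuts *)


Lemma inj_surj_bij (S T : Type) (f : S -> T) :
  injective f -> (forall y, exists x, f x = y) -> bijective f.
Proof.
by move=> f_inj /choice[g gK]; exists g => // x; apply: f_inj; rewrite gK.
Qed.

Lemma subforest_eq (L : finType) (F : forest L) (A B : subforest F) :
  A.1 = B.1 -> A.2 = B.2 -> A = B.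
Proof.
by move=> e1 e2; apply: val_inj;
  rewrite /= [LHS]surjective_pairing e1 e2 -surjective_pairing.
Qed.

Definition small_elt (N : smallFinType) (A : {set N}) (x : N) (xA : x \in A) :
  small_sub A := exist _ x xA.

Section Classes.
Context {d : nat} {L : finType}.
Implicit Types t u : dforest d L.

Lemma class_eqP t u :
  dforest_isomorphic t u <->
  \pi_(dforest_class d L)%qT t = \pi_(dforest_class d L)%qT u.
Proof.
split=> [tu|/eqmodP/asboolP //]; apply/eqmodP; exact/asboolP.
Qed.

(** The equalities of tensor factors below come from such maps on nodes and edges; checking
    injectivity and surjectivity avoids writing inverses on subtypes. *)
Lemma class_eq_of_maps t u (f : node t -> node u) (g : edge t -> edge u) :
  injective f -> (forall y, exists x, f x = y) ->
  injective g -> (forall y, exists x, g x = y) ->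
  (forall e, src (g e) = f (src e)) -> (forall e, tgt (g e) = f (tgt e)) ->
  (forall e, typ (g e) = typ e) ->
  (forall x, ncol (f x) = ncol x) -> (forall e, ecol (g e) = ecol e) ->
  (forall x, ndec (f x) = ndec x) -> (forall x, odec (f x) = odec x) ->
  (forall e, edec (g e) = edec e) ->
  \pi_(dforest_class d L)%qT t = \pi_(dforest_class d L)%qT u.
Proof.
move=> fi fs gi gs s0 t0 y0 nc ec nd od ed; apply/class_eqP.
by exists (ForestIso (inj_surj_bij fi fs) (inj_surj_bij gi gs) s0 t0 y0).
Qed.

Lemma class_repr t :
  dforest_isomorphic (repr (\pi_(dforest_class d L)%qT t)) t.
Proof. by apply/class_eqP; rewrite reprK. Qed.

(** [prod_basis] adds chosen representatives, which this lemma allows to replace. *)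
Lemma dsum_iso t u t' u' :
  dforest_isomorphic t t' -> dforest_isomorphic u u' ->
  \pi_(dforest_class d L)%qT (dsum t u) =
    \pi_(dforest_class d L)%qT (dsum t' u').
Proof.
move=> [f [[fc1 fc2] fn fo fe]] [g [[gc1 gc2] gn go ge]].
have [[f1 f1K f1K'] [f2 f2K f2K']] := (iso_node_bij f, iso_edge_bij f).
have [[g1 g1K g1K'] [g2 g2K g2K']] := (iso_node_bij g, iso_edge_bij g).
pose hn (x : node t + node u) : node t' + node u' :=
  match x with inl x => inl (iso_node f x) | inr x => inr (iso_node g x) end.
pose he (x : edge t + edge u) : edge t' + edge u' :=
  match x with inl x => inl (iso_edge f x) | inr x => inr (iso_edge g x) end.
apply: (@class_eq_of_maps (dsum t u) (dsum t' u') hn he).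
- by move=> [x|x] [y|y] // [] => [/(can_inj f1K)->|/(can_inj g1K)->].
- by case=> x; [exists (inl (f1 x))|exists (inr (g1 x))];
    rewrite /= ?f1K' ?g1K'.
- by move=> [x|x] [y|y] // [] => [/(can_inj f2K)->|/(can_inj g2K)->].
- by case=> x; [exists (inl (f2 x))|exists (inr (g2 x))];
    rewrite /= ?f2K' ?g2K'.
- by case=> e /=; rewrite iso_src.
- by case=> e /=; rewrite iso_tgt.
- by case=> e /=; rewrite iso_typ.
- by case=> x /=.
- by case=> x /=.
- by case=> x /=.
- by case=> x /=.
- by case=> x /=.
Qed.

End Classes.

(** * Pulling subforests and cuts back along an isomorphism *)

Section Preimage.
Context {L : finType} {F G : forest L}.

Lemma preim_subproof (f : forest_iso F G) (A : subforest G) :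
  @endpoints_in L F ([set x | iso_node f x \in A.1],
    [set e | iso_edge f e \in A.2])%SET.
Proof.
apply/forall_inP => e; rewrite !inE => eA.
by rewrite -iso_src -iso_tgt (sub_src eA) (sub_tgt eA).
Qed.

(** Cuts are transported by preimage, since membership in it unfolds to membership in [A]. *)
Definition preim_sub (f : forest_iso F G) (A : subforest G) : subforest F :=
  Subforest (preim_subproof f A).

Lemma preim_subK (f : forest_iso F G) (A : subforest G) :
  Defs.image_sub f (preim_sub f A) = A.
Proof.
have [[f1 f1K f1K'] [f2 f2K f2K']] := (iso_node_bij f, iso_edge_bij f).
apply: subforest_eq; apply/setP => x.
  apply/imsetP/idP => [[y]|xA]; first by rewrite inE => yA ->.
  by exists (f1 x); rewrite ?inE f1K'.
apply/imsetP/idP => [[y]|xA]; first by rewrite inE => yA ->.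
by exists (f2 x); rewrite ?inE f2K'.
Qed.

End Preimage.

Section Transport.
Context {d : nat} {L : finType} {AA : subforest_family L}.
Implicit Types t u : dforest d L.

Lemma cut_eq t (z w : cut (AA := AA) t) :
  cut_sub z = cut_sub w -> cut_eps z = cut_eps w -> cut_n z = cut_n w -> z = w.
Proof.
case: z => [[[A e] n] h]; case: w => [[[A' e'] n'] h'].
rewrite /cut_sub /cut_eps /cut_n /= => eA ee en.
by apply: val_inj; rewrite /= eA ee en.
Qed.

Lemma cut_exists t (A : subforest t) (eps : {ffun edge t -> mindex d})
    (n : {ffun node t -> mindex d}) :
  A \in AA t ->
  (forall e, eps e != 0%R -> (e \notin A.2) && (src e \in A.1)) ->
  (forall x, n x != 0%R -> x \in A.1) ->
  exists z : cut (AA := AA) t, [/\ cut_sub z = A, cut_eps z = eps & cut_n z =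
    n].
Proof.
move=> hA he hn; have z_cut : is_cut (AA := AA) (A, eps, n).
  by rewrite /is_cut hA /=; apply/andP; split; apply/forallP => x;
    apply/implyP => h; rewrite ?he ?hn.
by exists (exist (is_cut (AA := AA) (t := t)) (A, eps, n) z_cut).
Qed.

Section Pull.
Context {i : nat} (i_gt0 : 0 < i) (A1 : assumption1 i AA).
Context {t u : dforest d L} (f : forest_iso t u).
Hypothesis f_col : col_preserving f.

Definition pull_data (w : cut (AA := AA) u) : cut_data t :=
  (preim_sub f (cut_sub w), [ffun e => cut_eps w (iso_edge f e)],
   [ffun x => cut_n w (iso_node f x)]).

Lemma pull_subproof w : is_cut (AA := AA) (pull_data w).
Proof.
apply/and3P; split.
(* Assumption 1 speaks of images; [preim_subK] identifies the image of the preimage. *)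
- by rewrite -(A1.1 _ _ _ f_col) preim_subK cut_subP.
- apply/forallP => e; apply/implyP; rewrite ffunE => /cut_epsP.
  by rewrite !inE -iso_src.
- by apply/forallP => x; apply/implyP; rewrite ffunE inE => /cut_nP.
Qed.

Definition pull (w : cut u) : cut t := exist (is_cut (AA := AA) (t :=
  t)) _ (pull_subproof w).

Lemma pull_epsE w e : cut_eps (pull w) e = cut_eps w (iso_edge f e).
Proof. by rewrite [LHS]ffunE. Qed.

Lemma pull_nE w x : cut_n (pull w) x = cut_n w (iso_node f x).
Proof. by rewrite [LHS]ffunE. Qed.

Hypothesis f_ndec : forall x, ndec (iso_node f x) = ndec x.
Hypothesis f_odec : forall x, odec (iso_node f x) = odec x.
Hypothesis f_edec : forall e, edec (iso_edge f e) = edec e.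

Lemma pull_coef (R : realType) w : cut_coef R (pull w) = cut_coef R w.
Proof.
have [[f1 f1K f1K'] [f2 f2K f2K']] := (iso_node_bij f, iso_edge_bij f).
rewrite /cut_coef; congr (_%:R / _%:R)%R.
  rewrite [RHS](reindex (iso_node f)) /=; last by exists f1 => ? _.
  by apply: eq_bigr => x _; apply: eq_bigr => j _; rewrite pull_nE f_ndec.
rewrite [RHS](reindex (iso_edge f)) /=; last by exists f2 => ? _.
by apply: eq_bigr => x _; apply: eq_bigr => j _; rewrite pull_epsE.
Qed.

Lemma pull_sum (V : nmodType) (h : edge u -> V) x :
  (\sum_(e | src e == iso_node f x) h e =
   \sum_(e | src e == x) h (iso_edge f e))%R.
Proof.
have [f2 f2K f2K'] := iso_edge_bij f.
rewrite (reindex (iso_edge f)) /=; last by exists f2 => ? _.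
by apply: eq_bigl => e; rewrite iso_src (inj_eq (bij_inj (iso_node_bij f))).
Qed.

Lemma pull_left w :
  \pi_(dforest_class d L)%qT (left_term (pull w)) =
  \pi_(dforest_class d L)%qT (left_term w).
Proof.
have [[f1 f1K f1K'] [f2 f2K f2K']] := (iso_node_bij f, iso_edge_bij f).
have inn (x : node (left_term (pull w))) : iso_node f (val x) \in (cut_sub w).1.
  by have := valP x; rewrite inE.
have ine (x : edge (left_term (pull w))) : iso_edge f (val x) \in (cut_sub w).2.
  by have := valP x; rewrite inE.
pose gn x : node (left_term w) := small_elt (inn x).
pose ge x : edge (left_term w) := small_elt (ine x).
apply: (@class_eq_of_maps _ _ (left_term (pull w)) (left_term w) gn ge).
- by move=> x y [/(can_inj f1K)]; apply: val_inj.
- case=> y yA; have xA : f1 y \in (cut_sub (pull w)).1 by rewrite inE f1K'.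
  by exists (small_elt xA); apply: val_inj; rewrite /= f1K'.
- by move=> x y [/(can_inj f2K)]; apply: val_inj.
- case=> y yA; have xA : f2 y \in (cut_sub (pull w)).2 by rewrite inE f2K'.
  by exists (small_elt xA); apply: val_inj; rewrite /= f2K'.
- by move=> e; apply: val_inj; rewrite /= iso_src.
- by move=> e; apply: val_inj; rewrite /= iso_tgt.
- by move=> e; rewrite /= iso_typ.
- by move=> x; rewrite /= f_col.1.
- by move=> x; rewrite /= f_col.2.
- move=> x /=; rewrite /left_ndec /= pull_sum pull_nE; congr GRing.add.
  by apply: eq_bigr => e _; rewrite pull_epsE.
- by move=> x; rewrite /= /left_odec /= f_odec.
- by move=> x; rewrite /= /left_edec /= f_edec.
Qed.

Lemma pull_right w :
  \pi_(dforest_class d L)%qT (right_term i_gt0 A1 (pull w)) =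
  \pi_(dforest_class d L)%qT (right_term i_gt0 A1 w).
Proof.
have [[f1 f1K f1K'] [f2 f2K f2K']] := (iso_node_bij f, iso_edge_bij f).
have inN x : (x \in (cut_sub (pull w)).1) = (iso_node f x \in (cut_sub w).1).
  by rewrite inE.
have inE' e : (e \in (cut_sub (pull w)).2) = (iso_edge f e \in (cut_sub w).2).
  by rewrite inE.
apply: (@class_eq_of_maps _ _ (right_term i_gt0 A1 (pull w))
   (right_term i_gt0 A1 w) (iso_node f) (iso_edge f)).
- exact: can_inj f1K.
- by move=> y; exists (f1 y).
- exact: can_inj f2K.
- by move=> y; exists (f2 y).
- by move=> e; apply: iso_src.
- by move=> e; apply: iso_tgt.
- by move=> e; apply: iso_typ.
- by move=> x; rewrite [RHS]/= /cup_ncol inN [LHS]/= /cup_ncol f_col.1.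
- by move=> x; rewrite [RHS]/= /cup_ecol inE' [LHS]/= /cup_ecol f_col.2.
- by move=> x; apply/ffunP => j; rewrite [LHS]ffunE [RHS]ffunE f_ndec pull_nE.
- move=> x /=; rewrite /right_odec f_odec pull_sum pull_nE.
  congr (_ + to_odec L (_ + _))%R; apply: eq_bigr => e _.
  by rewrite inE' pull_epsE f_edec.
- by move=> e;
    rewrite [RHS]/= /right_edec inE' [LHS]/= /right_edec f_edec pull_epsE.
Qed.

End Pull.

Lemma pullK t u (f : forest_iso t u) (g : forest_iso u t) i (A1 : assumption1 i AA)
    (f_col : col_preserving f) (g_col : col_preserving g) :
  cancel (iso_node f) (iso_node g) -> cancel (iso_edge f) (iso_edge g) ->
  cancel (pull A1 g_col) (pull A1 f_col).
Proof.
move=> fK gK z; apply: cut_eq.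
- by apply: subforest_eq; apply/setP => x; rewrite !inE ?fK ?gK.
- by apply/ffunP => e; rewrite !pull_epsE gK.
- by apply/ffunP => x; rewrite !pull_nE fK.
Qed.

(** [pull] is a bijection of cuts that preserves coefficients and terms. Hence [Delta_map], defined
    through [repr], can be computed on any forest of the class. *)
Lemma Delta_iso (R : realType) i (i_gt0 : 0 < i) (A1 : assumption1 i AA) t u y :
  dforest_isomorphic t u ->
  Delta_dforest i_gt0 A1 t R y = Delta_dforest i_gt0 A1 u R y.
Proof.
case=> f [f_col fn fo fe]; have [g [gnK [geK [fnK feK]]]] := iso_inverse f.
have g_col : col_preserving g.
  by split=> x; [rewrite -f_col.1 fnK|rewrite -f_col.2 feK].
have pull_bij : bijective (pull A1 f_col).
  by exists (pull A1 g_col); apply: pullK.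
rewrite /Delta_dforest (reindex_fsbigT (pull A1 f_col)) //.
apply: eq_fsbigr => z _.
by rewrite pull_coef // /cut_term pull_left // pull_right.
Qed.

End Transport.

(** * Multiplicativity *)


Section CutSum.
Local Open Scope classical_set_scope.
Local Open Scope ring_scope.
Context {d : nat} {L : finType} {AA : subforest_family L} {R : realType}.
Context {i : nat} (i_gt0 : (0 < i)%N) (A1 : assumption1 i AA).
Implicit Types t : dforest d L.

(** The first degree of a term dominates the size of epsilon, which is what [finite_cuts] asks to be
    bounded. *)
Lemma finite_cut_term t n : finite_set
  [set z : cut (AA := AA) t | cut_coef R z != 0 /\
                              ((bideg (cut_term i_gt0 A1 z)).1 <= n)%N].
Proof.
apply: sub_finite_set (@finite_cuts _ _ AA t R n) => z [cz zn]; split=> //.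
by apply: leq_trans zn; rewrite cut_term_deg1 leq_addl.
Qed.

(** [Delta_dforest] groups the cuts by their term, and pairing with [G] undoes the grouping. The
    bound [n] makes the double sum finite, through [finite_cut_term]. *)
Lemma Delta_sum t (G : tensor (FF d L) (FF d L) -> R) n :
  (forall y, G y != 0 -> ((bideg y).1 <= n)%N) ->
  \sum_(y \in [set: tensor (FF d L) (FF d L)]) Delta_dforest i_gt0 A1 t R y * G y =
  \sum_(z \in [set: cut t]) cut_coef R z * G (cut_term i_gt0 A1 z).
Proof.
move=> Gn; under eq_fsbigr => y _ do rewrite mulr_fsuml.
rewrite fsum_exchange.
  apply: eq_fsbigr => z _; rewrite (@fsum_single _ _ _ (cut_term i_gt0 A1 z)).
    by rewrite eqxx mulr1.
  move=> y; rewrite 2!mulf_eq0 !negb_or => /andP[/andP[_]].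
  by case: (cut_term i_gt0 A1 z =P y) => //; rewrite eqxx.
apply: sub_finite_set
  (finite_image (fun z => (cut_term i_gt0 A1 z, z)) (finite_cut_term t n)).
move=> [y z]; rewrite [X in X -> _]/= 2!mulf_eq0 !negb_or =>
  /andP[/andP[cz yz] /Gn yn].
case: (cut_term i_gt0 A1 z =P y) yz yn => [<- _ yn|]; last by rewrite eqxx.
by exists z.
Qed.

End CutSum.

(** * Cuts of a disjoint union *)

Section Join.
Context {d : nat} {L : finType} {AA : subforest_family L}.
Context {i : nat} (i_gt0 : 0 < i) (A1 : assumption1 i AA) (A2 : assumption2 A1).
Context {t u : dforest d L}.

Definition join_fun (T U : finType) (V : Type) (f : T -> V) (g : U -> V) :
    {ffun (T + U)%type -> V} :=
  [ffun x : (T + U)%type => match x with inl x => f x | inr x => g x end].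

Definition join_data (z : cut (AA := AA) t) (w : cut (AA := AA) u) :
    cut_data (dsum t u) :=
  (subforest_sum (cut_sub z) (cut_sub w), join_fun (cut_eps z) (cut_eps w),
   join_fun (cut_n z) (cut_n w)).

Lemma in_sum1 (C : subforest t) (D : subforest u) x :
  (x \in (subforest_sum C D).1) =
  match x with inl x => x \in C.1 | inr x => x \in D.1 end.
Proof. by rewrite inE. Qed.

Lemma in_sum2 (C : subforest t) (D : subforest u) x :
  (x \in (subforest_sum C D).2) =
  match x with inl x => x \in C.2 | inr x => x \in D.2 end.
Proof. by rewrite inE. Qed.

Lemma join_subproof z w : is_cut (AA := AA) (join_data z w).
Proof.
apply/and3P; split.
- rewrite (A2.1 t u); apply/imset2P.
  by exists (cut_sub z) (cut_sub w) => //; apply: cut_subP.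
- apply/forallP => e; apply/implyP; rewrite ffunE in_sum1 in_sum2.
  by case: e => e /cut_epsP.
- by apply/forallP => x; apply/implyP; rewrite ffunE in_sum1;
    case: x => x /cut_nP.
Qed.

Definition join (p : cut (AA := AA) t * cut (AA := AA) u) : cut (dsum t u) :=
  exist (is_cut (AA := AA) (t := dsum t u)) _ (join_subproof p.1 p.2).

Lemma join_n p x : cut_n (join p) x =
  match x with inl x => cut_n p.1 x | inr x => cut_n p.2 x end.
Proof. by rewrite [LHS]ffunE. Qed.

Lemma join_eps p x : cut_eps (join p) x =
  match x with inl x => cut_eps p.1 x | inr x => cut_eps p.2 x end.
Proof. by rewrite [LHS]ffunE. Qed.

Lemma join_inj : injective join.
Proof.
move=> [z w] [z' w'] zw; congr pair; apply: cut_eq.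
- apply: subforest_eq; apply/setP => x.
    by have :=
      congr1 (fun v => (inl x : node (dsum t u)) \in (cut_sub v).1) zw;
      rewrite !in_sum1.
  by have := congr1 (fun v => (inl x : edge (dsum t u)) \in (cut_sub v).2) zw;
    rewrite !in_sum2.
- apply/ffunP => x.
  by have := congr1 (fun v : cut (dsum t u) => cut_eps v (inl x)) zw;
    rewrite !join_eps.
- apply/ffunP => x.
  by have := congr1 (fun v : cut (dsum t u) => cut_n v (inl x)) zw;
    rewrite !join_n.
- apply: subforest_eq; apply/setP => x.
    by have :=
      congr1 (fun v => (inr x : node (dsum t u)) \in (cut_sub v).1) zw;
      rewrite !in_sum1.
  by have := congr1 (fun v => (inr x : edge (dsum t u)) \in (cut_sub v).2) zw;
    rewrite !in_sum2.
- apply/ffunP => x.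
  by have := congr1 (fun v : cut (dsum t u) => cut_eps v (inr x)) zw;
    rewrite !join_eps.
- apply/ffunP => x.
  by have := congr1 (fun v : cut (dsum t u) => cut_n v (inr x)) zw;
    rewrite !join_n.
Qed.

(** The first item of assumption 2 splits the subforest of [w]; epsilon and n_A are then restricted
    to the two summands. *)
Lemma join_surj w : exists p, join p = w.
Proof.
have := cut_subP w; rewrite (A2.1 t u) => /imset2P[C D CA DA wCD].
have [z [zC ze zn]] : exists z : cut (AA := AA) t, [/\ cut_sub z = C,
    cut_eps z = [ffun e : edge t => cut_eps w (inl e)] &
    cut_n z = [ffun x : node t => cut_n w (inl x)]].
  apply: cut_exists => // [e|x]; rewrite ffunE.
    by move=> /cut_epsP; rewrite wCD in_sum1 in_sum2.
  by move=> /cut_nP; rewrite wCD in_sum1.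
have [z' [zC' ze' zn']] : exists z : cut (AA := AA) u, [/\ cut_sub z = D,
    cut_eps z = [ffun e : edge u => cut_eps w (inr e)] &
    cut_n z = [ffun x : node u => cut_n w (inr x)]].
  apply: cut_exists => // [e|x]; rewrite ffunE.
    by move=> /cut_epsP; rewrite wCD in_sum1 in_sum2.
  by move=> /cut_nP; rewrite wCD in_sum1.
exists (z, z'); apply: cut_eq.
- by rewrite wCD -zC -zC'.
- by apply/ffunP => -[e|e]; rewrite join_eps /= ?ze ?ze' ffunE.
- by apply/ffunP => -[e|e]; rewrite join_n /= ?zn ?zn' ffunE.
Qed.

Lemma join_coef (R : realType) p :
  cut_coef R (join p) = (cut_coef R p.1 * cut_coef R p.2)%R.
Proof.
rewrite /cut_coef mulrACA -invfM -!natrM; congr (_%:R / _%:R)%R.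
  rewrite [LHS](@big_sumType _ _ _ (node t) (node u) xpredT).
  by congr muln; apply: eq_bigr => x _; apply: eq_bigr => j _; rewrite join_n.
rewrite [LHS](@big_sumType _ _ _ (edge t) (edge u) xpredT).
by congr muln; apply: eq_bigr => x _; apply: eq_bigr => j _; rewrite join_eps.
Qed.

(** No edge joins the two summands. *)
Lemma join_sum (V : nmodType) (h : edge t + edge u -> V) x :
  (\sum_(e : edge (dsum t u) | src e == x) h e =
   match x with
   | inl x => \sum_(e | src e == x) h (inl e)
   | inr x => \sum_(e | src e == x) h (inr e)
   end)%R.
Proof.
rewrite [LHS](@big_sumType _ _ _ (edge t) (edge u) (fun e => sum_src e == x)).
case: x => x /=; first by rewrite [X in (_ + X)%R]big_pred0 ?addr0.
by rewrite [X in (X + _)%R]big_pred0 ?add0r.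
Qed.

Lemma join_left p :
  \pi_(dforest_class d L)%qT (dsum (left_term p.1) (left_term p.2)) =
  \pi_(dforest_class d L)%qT (left_term (join p)).
Proof.
set A := cut_sub p.1; set B := cut_sub p.2.
have inN (x : sub_node A + sub_node B) : (match x with
    | inl x => inl (val x) | inr x => inr (val x) end : node (dsum t u))
    \in (cut_sub (join p)).1.
  by rewrite in_sum1; case: x => x; apply: valP.
have inE' (x : sub_edge A + sub_edge B) : (match x with
    | inl x => inl (val x) | inr x => inr (val x) end : edge (dsum t u))
    \in (cut_sub (join p)).2.
  by rewrite in_sum2; case: x => x; apply: valP.
pose gn x : node (left_term (join p)) := small_elt (inN x).
pose ge x : edge (left_term (join p)) := small_elt (inE' x).
apply: (@class_eq_of_maps _ _ (dsum (left_term p.1) (left_term p.2))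
  (left_term (join p)) gn ge).
- by move=> [x|x] [y|y] [] // /val_inj ->.
- case=> -[y|y] yA; have := yA; rewrite in_sum1 => yA'.
    by exists (inl (small_elt yA')); apply: val_inj.
  by exists (inr (small_elt yA')); apply: val_inj.
- by move=> [x|x] [y|y] [] // /val_inj ->.
- case=> -[y|y] yA; have := yA; rewrite in_sum2 => yA'.
    by exists (inl (small_elt yA')); apply: val_inj.
  by exists (inr (small_elt yA')); apply: val_inj.
- by case=> e; apply: val_inj.
- by case=> e; apply: val_inj.
- by case=> e.
- by case=> x.
- by case=> x.
- case=> x; rewrite /= /left_ndec /= join_n join_sum /=; congr GRing.add;
    by apply: eq_bigr => e _; rewrite join_eps.
- by case=> x.
- by case=> x.
Qed.

(** Both sides have the nodes and edges of the disjoint union of [t] and [u], so the identity maps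
    give the isomorphism. *)
Lemma join_right p :
  \pi_(dforest_class d L)%qT
    (dsum (right_term i_gt0 A1 p.1) (right_term i_gt0 A1 p.2)) =
  \pi_(dforest_class d L)%qT (right_term i_gt0 A1 (join p)).
Proof.
have inN x : (x \in (cut_sub (join p)).1) = match x with
    inl x => x \in (cut_sub p.1).1 | inr x => x \in (cut_sub p.2).1 end.
  exact: in_sum1.
have inE' x : (x \in (cut_sub (join p)).2) = match x with
    inl x => x \in (cut_sub p.1).2 | inr x => x \in (cut_sub p.2).2 end.
  exact: in_sum2.
apply: (@class_eq_of_maps _ _
  (dsum (right_term i_gt0 A1 p.1) (right_term i_gt0 A1 p.2))
  (right_term i_gt0 A1 (join p)) id id) => //; try by move=> y; exists y.
- by move=> x; rewrite [LHS]/= /cup_ncol inN; case: x.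
- by move=> e; rewrite [LHS]/= /cup_ecol inE'; case: e.
- by move=> x; apply/ffunP => j; rewrite [LHS]ffunE join_n; case: x => x;
    rewrite [RHS]ffunE.
- move=> x; rewrite [LHS]/= /right_odec join_n join_sum; case: x => x;
  congr (_ + to_odec L (_ + _))%R; apply: eq_bigr => e _;
  by rewrite join_eps inE'.
- by move=> e; rewrite [LHS]/= /right_edec join_eps inE'; case: e.
Qed.

Lemma join_term p : cut_term i_gt0 A1 (join p) =
  prod2_basis (cut_term i_gt0 A1 p.1, cut_term i_gt0 A1 p.2).
Proof.
rewrite /cut_term -join_left -join_right /prod2_basis /prod_basis /=.
by congr pair; apply: dsum_iso; apply/class_eqP; rewrite reprK.
Qed.

End Join.

(** * The coproduct of a product *)

Section Multiplicative.
Local Open Scope classical_set_scope.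
Local Open Scope ring_scope.
Context {d : nat} {L : finType} {AA : subforest_family L} {R : realType}.
Context {i : nat} (i_gt0 : (0 < i)%N) (A1 : assumption1 i AA).
Hypothesis A2 : assumption2 A1.

(** Expanding both factors by [Delta_sum] gives a sum over pairs of cuts, which [join] carries to
    the cuts of the disjoint union. *)
Lemma Delta_dsum (t u : dforest d L) y :
  Delta_dforest i_gt0 A1 (dsum t u) R y =
  \sum_(p \in [set: tensor (FF d L) (FF d L)]) Delta_dforest i_gt0 A1 t R p *
    \sum_(q \in [set: tensor (FF d L) (FF d L)])
      Delta_dforest i_gt0 A1 u R q * (y == prod2_basis (p, q))%:R.
Proof.
(* The bidegree is additive, so that of [y] bounds those of both factors. *)
have prod_deg (p q : tensor (FF d L) (FF d L)) :
    (y == prod2_basis (p, q))%:R != 0 :> R ->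
    ((bideg p).1 <= (bideg y).1)%N /\ ((bideg q).1 <= (bideg y).1)%N.
  case: (y =P _) => [->|]; last by rewrite eqxx.
  by rewrite prod2_basis_deg /= => _; split; [apply: leq_addr|apply: leq_addl].
rewrite (@Delta_sum _ _ _ _ _ _ _ _ _ (bideg y).1); last first.
  by move=> p /fsbig_neq0[q]; rewrite mulf_eq0 negb_or => /andP[_ /prod_deg[]].
under [RHS]eq_fsbigr => z _.
  rewrite (@Delta_sum _ _ _ _ _ _ _ _ _ (bideg y).1); last first.
    by move=> q /prod_deg[].
  rewrite mulr_fsumr; over.
rewrite -(fsum_pair (F := fun p : cut t * cut u => cut_coef R p.1 *
  (cut_coef R p.2 *
   (y == prod2_basis (cut_term i_gt0 A1 p.1, cut_term i_gt0 A1 p.2))%:R))).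
  rewrite /Delta_dforest (fsum_reindex (h := join A2)).
  - by apply: eq_fsbigr => p _;
      rewrite join_coef (join_term i_gt0) mulrA eq_sym.
  - exact: join_inj.
  - by move=> w _; apply: join_surj.
apply: sub_finite_set (finite_setX (finite_cut_term (R :=
  R) i_gt0 A1 t (bideg y).1)
  (finite_cut_term (R := R) i_gt0 A1 u (bideg y).1)).
move=> [z w] /=; rewrite mulf_eq0 negb_or => /andP[cz].
by rewrite mulf_eq0 negb_or => /andP[cw /prod_deg[]].
Qed.

Lemma Delta_mul (f g : series R (FF d L)) :
  Delta i_gt0 A1 (forest_prod f g) =
  forest_prod2 (Delta i_gt0 A1 f) (Delta i_gt0 A1 g).
Proof.
rewrite /Delta /forest_prod /forest_prod2 tens_extend !extend_comp.
apply: eq_extend => -[a b] y; rewrite [LHS]/= /extend_coef.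
(* The product of two basis vectors is a single basis vector. *)
rewrite (@fsum_single _ _ _ (prod_basis (a, b))); last first.
  move=> c; rewrite mulf_eq0 negb_or => /andP[+ _]; rewrite /= /delta_coef.
  by case: (c =P _) => //; rewrite eqxx.
(* [Delta_iso] replaces the representative of the product class by the disjoint union itself. *)
rewrite /= /delta_coef eqxx mul1r (Delta_iso _ i_gt0 A1 y (class_repr _)) Delta_dsum.
rewrite [RHS]fsum_pair.
  apply: eq_fsbigr => p _; rewrite mulr_fsumr; apply: eq_fsbigr => q _.
  by rewrite /tens_coef /= mulrA.
exact: (@extend_supp _ (tensor _ _)).
Qed.

End Multiplicative.

(** * The Vandermonde identity over a map of finite sets *)


Section Vandermonde.
Context {R : comNzRingType}.
Local Open Scope ring_scope.

Lemma coef_exp1X k j : ((1 + 'X) ^+ k : {poly R})`_j = 'C(k, j)%:R.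
Proof.
elim: k j => [|k IH] j; first by rewrite expr0 coef1 bin0n.
rewrite exprSr mulrDr mulr1 coefD coefMX !IH.
by case: j => [|j]; rewrite /= ?addr0 ?bin0 // binS natrD.
Qed.

(** A bound [K] common to all exponents gives the factors of a product one and the same index
    type. *)
Lemma exp1X_sum k K : (k <= K)%N ->
  (1 + 'X) ^+ k = \sum_(j < K.+1) 'C(k, j)%:R *: 'X^j :> {poly R}.
Proof.
move=> kK; rewrite -(poly_def _ (fun j => 'C(k, j)%:R)); apply/polyP => j.
rewrite coef_poly coef_exp1X; case: ifPn => //; rewrite -leqNgt => Kj.
by rewrite bin_small //; apply: leq_trans Kj.
Qed.

(** Both sides are the coefficient of ['X^n] in (1 + X)^m times the product of the (1 + X)^(k e).
    The term of index [f] carries X to the power sum of [f]; the boolean factor discards the terms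
    where this power exceeds [n] and the subtraction is truncated. *)
Lemma Vandermonde_family (E : finType) (P : pred E) (k : E -> nat) K m n :
  (forall e, (k e <= K)%N) ->
  'C(m + \sum_(e | P e) k e, n)%N%:R =
  \sum_(f : {ffun E -> 'I_K.+1} | f \in pfamily ord0 P (fun=> predT))
    ((\sum_(e | P e) f e <= n) * 'C(m, n - \sum_(e | P e) f e))%N%:R *
    \prod_(e | P e) 'C(k e, f e)%:R :> R.
Proof.
move=> kK; rewrite -coef_exp1X exprD -prodrXr.
under eq_bigr => e _ do rewrite (exp1X_sum (kK e)).
rewrite (big_distr_big_dep ord0) /= mulr_sumr coef_sum; apply: eq_bigr => f _.
rewrite scaler_prod -scalerAr coefZ mulrC; congr (_ * _).
rewrite prodrXr coefMXn coef_exp1X ltnNge; case: leqP => _ /=.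
  by rewrite mul1n.
by rewrite mul0n.
Qed.

(** A function on [E] amounts to a family of functions on the fibres of [s], each extended by [t0].
    Expanding the product of sums gives a sum over such families, which [cutf] and [glue] match with
    functions on [E]. *)
Lemma sum_ffun_fibers (N E T : finType) (t0 : T) (s : E -> N)
    (G : N -> {ffun E -> T} -> R) :
  (forall x (h h' : {ffun E -> T}),
     (forall e, s e = x -> h e = h' e) -> G x h = G x h') ->
  \sum_(h : {ffun E -> T}) \prod_x G x h =
  \prod_x \sum_(f : {ffun E -> T} | f \in pfamily t0 (fun e => s e == x) (fun=> predT)) G x f.
Proof.
move=> Gloc; rewrite bigA_distr_big_dep /=.
pose glue (f : {ffun N -> {ffun E -> T}}) : {ffun E -> T} :=
  [ffun e => f (s e) e].
pose cutf (h : {ffun E -> T}) : {ffun N -> {ffun E -> T}} :=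
  [ffun x => [ffun e => if s e == x then h e else t0]].
rewrite [RHS](reindex_onto cutf glue) /=.
  apply: eq_big => [h|h _].
    apply/esym/andP; split.
      apply/familyP => x; rewrite !ffunE; apply/pfamilyP; split=> //.
      by apply/supportP => e; rewrite unfold_in ffunE => /negPf->.
    by apply/eqP/ffunP => e; rewrite !ffunE eqxx.
  by apply: eq_bigr => x _; apply: Gloc => e <-; rewrite !ffunE eqxx.
move=> f /familyP fP; apply/ffunP => x; apply/ffunP => e; rewrite !ffunE.
case: eqP => [<- //|/eqP sx].
by have /pfamilyP[/supportP-> //] := fP x; rewrite unfold_in.
Qed.

(** [Vandermonde_family] applies in each fibre; each factor depends on one fibre of [h] only, so the
    product of sums becomes a single sum over [h]. *)
Lemma Vandermonde_fibers (N E : finType) (s : E -> N) (m n : N -> nat)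
    (k : E -> nat) K : (forall e, (k e <= K)%N) ->
  (\prod_x 'C(m x + \sum_(e | s e == x) k e, n x))%N%:R =
  \sum_(h : {ffun E -> 'I_K.+1})
    (\prod_x ((\sum_(e | s e == x) h e <= n x) *
              'C(m x, n x - \sum_(e | s e == x) h e)) *
     \prod_e 'C(k e, h e))%N%:R :> R.
Proof.
move=> kK; rewrite natr_prod.
under eq_bigr => x _ do rewrite (Vandermonde_family _ _ _ kK).
rewrite -sum_ffun_fibers; last first.
  move=> x h h' hh'; have -> : (\sum_(e | s e == x) h e =
    \sum_(e | s e == x) h' e)%N.
    by apply: eq_bigr => e /eqP/hh' ->.
  by congr (_ * _); apply: eq_bigr => e /eqP/hh' ->.
apply: eq_bigr => h _; rewrite big_split natrM !natr_prod /=; congr (_ * _).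
by rewrite (partition_big s xpredT).
Qed.

End Vandermonde.

(** * Iterated cuts *)


Section Extension.
Context {N : smallFinType} (B : {set N}) {V : Type} (v0 : V).

Definition ext_fun (f : {ffun small_sub B -> V}) : {ffun N -> V} :=
  [ffun x : N => oapp f v0 (insub x)].

Lemma ext_funE f (x : small_sub B) : ext_fun f (val x) = f x.
Proof. by rewrite ffunE valK. Qed.

Lemma ext_fun_out f (x : N) : x \notin B -> ext_fun f x = v0.
Proof. by move=> xB; rewrite ffunE insubN. Qed.

Lemma ext_fun_inj : injective ext_fun.
Proof.
by move=> f g fg; apply/ffunP => x; rewrite -!ext_funE fg.
Qed.

End Extension.

Section SubExtension.
Context {L : finType} {F : forest L}.

Lemma ext_sub_subproof (B : subforest F) (A : subforest (restr B)) :
  @endpoints_in L F ((fun x : sub_node B => (val x : node F)) @: A.1,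
                     (fun e : sub_edge B => (val e : edge F)) @: A.2)%SET.
Proof.
apply/forall_inP => _ /imsetP[e eA ->]; apply/andP; split.
  exact: (imset_f (fun x : sub_node B => (val x : node F)) (sub_src eA)).
exact: (imset_f (fun x : sub_node B => (val x : node F)) (sub_tgt eA)).
Qed.

Definition ext_sub (B : subforest F) (A : subforest (restr B)) : subforest F :=
  Subforest (ext_sub_subproof A).

Lemma ext_subE1 (B : subforest F) (A : subforest (restr B)) (x : sub_node B) :
  (val x \in (ext_sub A).1) = (x \in A.1).
Proof. by rewrite (mem_imset (f := fun x : sub_node B => (val x : node F))) //;
  apply: val_inj. Qed.

Lemma ext_subE2 (B : subforest F) (A : subforest (restr B)) (e : sub_edge B) :
  (val e \in (ext_sub A).2) = (e \in A.2).
Proof. by rewrite (mem_imset (f := fun x : sub_edge B => (val x : edge F))) //;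
  apply: val_inj. Qed.

Lemma ext_sub_included (B : subforest F) (A : subforest (restr B)) :
  included (ext_sub A) B.
Proof.
by apply/andP; split; apply/fintype.subsetP => _ /imsetP[x _ ->]; apply: valP.
Qed.

(** With [ext_inside], identifies the subforests of the forest [B] with the subforests of [F]
    included in [B], the form in which the second item of assumption 2 uses them. *)
Lemma inside_ext (B : subforest F) (A : subforest (restr B)) :
  inside B (ext_sub A) = A.
Proof.
apply: subforest_eq; apply/setP => x.
  by rewrite -[RHS]ext_subE1 [LHS]inE.
by rewrite -[RHS]ext_subE2 [LHS]inE.
Qed.

Lemma ext_inside (B A : subforest F) : included A B -> ext_sub (inside B A) = A.
Proof.
case/andP => /fintype.subsetP AB1 /fintype.subsetP AB2.
apply: subforest_eq; apply/setP => x.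
  apply/imsetP/idP => [[y]|xA]; first by rewrite inE => yA ->.
  by exists (small_elt (AB1 _ xA)); rewrite ?inE.
apply/imsetP/idP => [[y]|xA]; first by rewrite inE => yA ->.
by exists (small_elt (AB2 _ xA)); rewrite ?inE.
Qed.

(** Turns sums at a node of [B] into sums over edges of [F], where both iterated cuts are
    compared. *)
Lemma sub_sum (V : nmodType) (B : subforest F) (G : edge F -> V)
    (x : node (restr B)) :
  (\sum_(e : edge (restr B) | src e == x) G (val e) =
   \sum_(e | src e == val x) (if e \in B.2 then G e else 0))%R.
Proof.
rewrite -big_mkcondr /= (eq_bigl (fun e => (e \in B.2) && (src e == val x))).
  rewrite [RHS]big_mkcondr [LHS]big_mkcond.
  exact/esym/(@big_sub V 0%R +%R%R (edge F) (mem B.2)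
    (fun e => if src e == val x then G e else 0%R)).
by move=> e; rewrite andbC.
Qed.

End SubExtension.


(** * The compatibility relation between left and right iterated cuts *)

Section IteratedCuts.
Context {d : nat} {L : finType} {AA : subforest_family L}.
Context {i : nat} (i_gt0 : 0 < i) (A1 : assumption1 i AA).
Context (t : dforest d L).
Local Open Scope ring_scope.

Definition pi_sum (h : edge t -> mindex d) (x : node t) : mindex d :=
  \sum_(e | src e == x) h e.

Definition left_cuts : choiceType :=
  {z : cut (AA := AA) t & cut (AA := AA) (left_term z)}.
Definition right_cuts : choiceType :=
  {z : cut (AA := AA) t & cut (AA := AA) (right_term i_gt0 A1 z)}.

(* The data A, eps_A, n_A live on the forest B; they are transported to [t],
   with value 0 outside B. *)
Section Left.
Variable l : left_cuts.
Definition lB : subforest t := cut_sub (tag l).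
Definition lepsB : {ffun edge t -> mindex d} := cut_eps (tag l).
Definition lnB : {ffun node t -> mindex d} := cut_n (tag l).
Definition lA : subforest t := ext_sub (cut_sub (tagged l)).
Definition lepsA : {ffun edge t -> mindex d} :=
  ext_fun (B := lB.2) 0 (cut_eps (tagged l)).
Definition lnA : {ffun node t -> mindex d} :=
  ext_fun (B := lB.1) 0 (cut_n (tagged l)).

Lemma lAE1 (x : node (restr lB)) :
  (x \in (cut_sub (tagged l)).1) = (val x \in lA.1).
Proof. by rewrite ext_subE1. Qed.

Lemma lAE2 (e : edge (restr lB)) :
  (e \in (cut_sub (tagged l)).2) = (val e \in lA.2).
Proof. by rewrite ext_subE2. Qed.

Lemma lepsAE (e : edge (restr lB)) : cut_eps (tagged l) e = lepsA (val e).
Proof. by rewrite /lepsA ext_funE. Qed.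

Lemma lnAE (x : node (restr lB)) : cut_n (tagged l) x = lnA (val x).
Proof. by rewrite /lnA ext_funE. Qed.

Lemma lA_included : included lA lB.
Proof. exact: ext_sub_included. Qed.

Lemma lepsA_out e : e \notin lB.2 -> lepsA e = 0.
Proof. exact: ext_fun_out. Qed.

Lemma lnA_out x : x \notin lB.1 -> lnA x = 0.
Proof. exact: ext_fun_out. Qed.

Lemma lepsAP e : lepsA e != 0 -> (e \notin lA.2) && (src e \in lA.1).
Proof.
case: (boolP (e \in lB.2)) => [eB|/lepsA_out->]; last by rewrite eqxx.
have -> : e = val (small_elt eB : edge (restr lB)) by [].
by rewrite -lepsAE -lAE2 => /cut_epsP; rewrite lAE1.
Qed.

Lemma lnAP x : lnA x != 0 -> x \in lA.1.
Proof.
case: (boolP (x \in lB.1)) => [xB|/lnA_out->]; last by rewrite eqxx.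
have -> : x = val (small_elt xB : node (restr lB)) by [].
by rewrite -lnAE -lAE1; apply: cut_nP.
Qed.

End Left.

(** The second cuts are comparable only once the first ones are identified; after that, extension
    from B to [t] is injective. *)
Lemma left_cuts_eq l l' :
  lB l = lB l' -> lepsB l = lepsB l' -> lnB l = lnB l' ->
  lA l = lA l' -> lepsA l = lepsA l' -> lnA l = lnA l' -> l = l'.
Proof.
case: l l' => [z w] [z' w'] eB eepsB enB.
have ez : z = z' by apply: cut_eq.
case: _ / ez in w' {eB eepsB enB} * => eA eeps en; congr existT; apply: cut_eq.
- by rewrite -[LHS]inside_ext -[RHS]inside_ext; congr inside.
- exact: ext_fun_inj eeps.
- exact: ext_fun_inj en.
Qed.

Section Right.
Variable r : right_cuts.
Definition rA : subforest t := cut_sub (tag r).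
Definition repsA : {ffun edge t -> mindex d} := cut_eps (tag r).
Definition rnA : {ffun node t -> mindex d} := cut_n (tag r).
(** The right term keeps the nodes and edges of [t], so the second cut on this side is already given
    on [t]. *)
Definition rB : subforest t := cut_sub (tagged r).
Definition repsB : {ffun edge t -> mindex d} := cut_eps (tagged r).
Definition rnB : {ffun node t -> mindex d} := cut_n (tagged r).

(** This is the function h over which the Vandermonde identity sums. *)
Definition out_eps : {ffun edge t -> mindex d} :=
  [ffun e => if e \in rB.2 then 0 else repsA e].

Lemma out_epsE e : out_eps e = if e \in rB.2 then 0 else repsA e.
Proof. by rewrite ffunE. Qed.

Lemma repsAP e : repsA e != 0 -> (e \notin rA.2) && (src e \in rA.1).
Proof. exact: (@cut_epsP _ _ AA t (tag r) e). Qed.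

Lemma rnAP x : rnA x != 0 -> x \in rA.1.
Proof. exact: (@cut_nP _ _ AA t (tag r) x). Qed.

Lemma repsBP e : repsB e != 0 -> (e \notin rB.2) && (src e \in rB.1).
Proof. exact: (@cut_epsP _ _ AA (right_term i_gt0 A1 (tag r)) (tagged r) e). Qed.

Lemma rnBP x : rnB x != 0 -> x \in rB.1.
Proof. exact: (@cut_nP _ _ AA (right_term i_gt0 A1 (tag r)) (tagged r) x). Qed.

End Right.

Lemma right_cuts_eq r r' :
  rA r = rA r' -> repsA r = repsA r' -> rnA r = rnA r' ->
  rB r = rB r' -> repsB r = repsB r' -> rnB r = rnB r' -> r = r'.
Proof.
case: r r' => [z w] [z' w'] eB eepsB enB.
have ez : z = z' by apply: cut_eq.
by case: _ / ez in w' {eB eepsB enB} * => eA eeps en; congr existT;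
  apply: cut_eq.
Qed.

(** The equations between left and right data, with h = [out_eps r]. A relation, rather than a map,
    states them on [t] without building cuts of dependent type. *)
Record compat (l : left_cuts) (r : right_cuts) : Prop := Compat {
  compat_B : lB l = rB r;
  compat_A : lA l = rA r;
  compat_repsA : forall e, repsA r e = lepsA l e + out_eps r e;
  compat_lepsB : forall e, lepsB l e = out_eps r e + repsB r e;
  compat_lnA : forall x, lnA l x = rnA r x + pi_sum (out_eps r) x;
  compat_lnB : forall x, lnB l x = rnA r x + rnB r x }.

Lemma mindexI (m : mindex d) : injective (+%R m).
Proof.
move=> a b /ffunP ab; apply/ffunP => j; apply: (@addnI (m j)).
by have := ab j; rewrite !ffunE.
Qed.

Lemma sum_neq0 (I : finType) (P : pred I) (F : I -> mindex d) :
  \sum_(e | P e) F e != 0 -> exists2 e, P e & F e != 0.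
Proof.
move=> h; apply/exists_inP; apply: contraT => /exists_inPn F0.
by case/eqP: h; apply: big1 => e /F0; rewrite negbK => /eqP.
Qed.

(** The equations give every component of the left cut directly, except eps_A, found by cancelling h
    in eps'_A = eps_A + h. *)
Lemma compat_inj_left l l' r : compat l r -> compat l' r -> l = l'.
Proof.
move=> c c'; have eB : lB l = lB l' by rewrite (compat_B c) (compat_B c').
apply: left_cuts_eq => //.
- by apply/ffunP => e; rewrite (compat_lepsB c) (compat_lepsB c').
- by apply/ffunP => e; rewrite (compat_lnB c) (compat_lnB c').
- by rewrite (compat_A c) (compat_A c').
- apply/ffunP => e; apply: (@mindexI (out_eps r e)).
  by rewrite ![_ + lepsA _ _]addrC -(compat_repsA c) -(compat_repsA c').
- by apply/ffunP => e; rewrite (compat_lnA c) (compat_lnA c').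
Qed.

(** Once h is known, n'_A follows by cancelling pi h, then eps'_B by cancelling h and n'_B by
    cancelling n'_A. *)
Lemma compat_inj_right l r r' : compat l r -> compat l r' ->
  out_eps r = out_eps r' -> r = r'.
Proof.
move=> c c' ee.
have enA : rnA r = rnA r'.
  apply/ffunP => x; apply: (@mindexI (pi_sum (out_eps r) x)).
  by rewrite addrC -(compat_lnA c) ee addrC -(compat_lnA c').
apply: right_cuts_eq => //.
- by rewrite -(compat_A c) -(compat_A c').
- by apply/ffunP => e; rewrite (compat_repsA c) (compat_repsA c') ee.
- by rewrite -(compat_B c) -(compat_B c').
- apply/ffunP => e; apply: (@mindexI (out_eps r e)).
  by rewrite -(compat_lepsB c) ee -(compat_lepsB c').
- apply/ffunP => x; apply: (@mindexI (rnA r x)).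
  by rewrite -(compat_lnB c) enA -(compat_lnB c').
Qed.

Hypothesis A2 : assumption2 A1.

Lemma cup_mem (F : cforest L) (A B : subforest F) (p q : admissible i A) :
  (B \in AA (cup p)) = (B \in AA (cup q)).
Proof. by rewrite (Prop_irrelevance p q). Qed.

(** The second item of assumption 2, read from the right iterated cut towards the left one. *)
Lemma right_cutsP r :
  [/\ rB r \in AA t, included (rA r) (rB r) &
      inside (rB r) (rA r) \in AA (crestr (rB r))].
Proof.
apply/(A2.2 t (rA r) (rB r)); exists (cut_subP (tag r)).
have h : rB r \in AA (cup (cut_adm A1 (tag r))) := cut_subP (tagged r).
by move: h; rewrite (cup_mem _ _ (subforest_family_adm A1 (cut_subP (tag r)))).
Qed.

(** Only supports have to be checked. The function h lives on edges outside B that leave A, so h +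
    eps'_B is allowed for B, while n'_A + pi h is supported in A; eps_A is the restriction of eps'_A
    to B. *)
Lemma compat_ex_left r : exists l, compat l r.
Proof.
have [hB AB hin] := right_cutsP r.
have /andP[/fintype.subsetP AB1 /fintype.subsetP AB2] := AB.
have out0 e : out_eps r e != 0 ->
    [/\ e \notin (rB r).2, e \notin (rA r).2 & src e \in (rA r).1].
  rewrite ffunE; case: ifP => [_|/negbT eB /repsAP/andP[-> ->]//].
  by rewrite eqxx.
have [|e|x|z [zB ze zn]] := @cut_exists _ _ AA t (rB r)
  [ffun e => out_eps r e + repsB r e] [ffun x => rnA r x + rnB r x].
- by [].
- rewrite ffunE; have [->|/out0[-> _ /AB1 ->]//] := eqVneq (out_eps r e) 0.
  by rewrite add0r; apply: repsBP.
- rewrite ffunE; have [->|/rnAP/AB1 //] := eqVneq (rnA r x) 0.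
  by rewrite add0r; apply: rnBP.
(* If pi h does not vanish at [x], some edge carrying h leaves [x], which is thus in A. *)
have nz x : rnA r x + pi_sum (out_eps r) x != 0 -> x \in (rA r).1.
  have [->|/rnAP //] := eqVneq (rnA r x) 0;
    rewrite add0r => /sum_neq0[e /eqP <-].
  by case/out0.
(* From here B is written [cut_sub z], as the type of a cut of [left_term z] requires. *)
rewrite -zB in AB AB1 AB2 hin.
have [|e|x|w [wA we wn]] := @cut_exists _ _ AA (left_term z)
  (inside (cut_sub z) (rA r))
  [ffun e : edge (restr (cut_sub z)) => repsA r (val e)]
  [ffun x : node (restr (cut_sub z)) =>
     rnA r (val x) + pi_sum (out_eps r) (val x)].
- exact: hin.
- by rewrite ffunE => /repsAP; rewrite !inE.
- by rewrite ffunE inE => /nz.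
exists (existT _ z w : left_cuts); split=> //.
- by rewrite /lA /= wA ext_inside.
- move=> e; case: (boolP (e \in (cut_sub z).2)) => eB; last first.
    by rewrite lepsA_out // add0r out_epsE -zB (negPf eB).
  have -> : e = val (small_elt eB : edge (restr (cut_sub z))) by [].
  rewrite out_epsE -[in RHS]zB eB addr0.
  have /= <- := lepsAE (l := existT _ z w) (small_elt eB).
  by rewrite we ffunE.
- by move=> e; rewrite /lepsB /= ze ffunE.
- move=> x; case: (boolP (x \in (cut_sub z).1)) => xB; last first.
    rewrite lnA_out //; apply/esym/eqP/(contraNT _ xB) => /nz; apply: AB1.
  have -> : x = val (small_elt xB : node (restr (cut_sub z))) by [].
  have /= <- := lnAE (l := existT _ z w) (small_elt xB).
  by rewrite wn ffunE.
- by move=> x; rewrite /lnB /= zn ffunE.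
Qed.

End IteratedCuts.


(** * Right cuts recovered from left cuts, and equality of the tensor factors *)

Section CompatibleCuts.
Context {d : nat} {L : finType} {AA : subforest_family L}.
Context {i : nat} (i_gt0 : 0 < i) (A1 : assumption1 i AA).
Context (t : dforest d L).
Hypothesis A2 : assumption2 A1.
Local Open Scope ring_scope.
Local Notation left_cuts := (left_cuts (AA := AA) t).
Local Notation right_cuts := (right_cuts i_gt0 A1 t).

Lemma mindex_neq0 (m : mindex d) : m != 0 -> exists j, m j != 0%N.
Proof.
move=> m0; apply/existsP; apply: contraT; rewrite negb_exists => /forallP m0'.
by case/eqP: m0; apply/ffunP => j; rewrite ffunE; apply/eqP;
  rewrite -[_ == _]negbK m0'.
Qed.

Lemma mindexD (m n : mindex d) j : (m + n) j = (m j + n j)%N.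
Proof. by rewrite ffunE. Qed.

Lemma pi_sumE (h : edge t -> mindex d) x j :
  pi_sum h x j = (\sum_(e | src e == x) h e j)%N.
Proof. by rewrite /pi_sum sum_ffunE. Qed.

(** The three inequalities make the truncated subtractions exact in n'_A = n_A - pi h, n'_B = n_B -
    n'_A and eps'_B = eps_B - h. They hold whenever the Vandermonde summand of [h] is non-zero. *)
Lemma compat_ex_right (l : left_cuts) (h : {ffun edge t -> mindex d}) :
  (forall x j, pi_sum h x j <= lnA l x j)%N ->
  (forall x j, lnA l x j - pi_sum h x j <= lnB l x j)%N ->
  (forall e j, h e j <= lepsB l e j)%N ->
  exists2 r : right_cuts, compat l r & out_eps r = h.
Proof.
move=> hA hB he.
have [hB' [hA' inc]] : lB l \in AA t /\ inside (lB l) (lA l) \in AA (crestr (lB l)) /\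
    included (lA l) (lB l).
  split; first exact: cut_subP.
  by split; [rewrite inside_ext;
    apply: (cut_subP (tagged l))|apply: lA_included].
have [hA1 hB1] : exists hA : lA l \in AA t,
    lB l \in AA (cup (subforest_family_adm A1 hA)) by apply/(A2.2 t (lA l) (lB l)).
have /andP[/fintype.subsetP AB1 /fintype.subsetP AB2] := inc.
(* Edges carrying [h] lie outside B because [h] is below eps_B, and leave A because pi h is below
   n_A. *)
have h0 e : h e != 0 -> [/\ e \notin (lB l).2,
  e \notin (lA l).2 & src e \in (lA l).1].
  move=> /mindex_neq0[j]; rewrite -lt0n => hj.
  have /(@cut_epsP _ _ AA t (tag l))/andP[eB _] : lepsB l e != 0.
    apply/eqP => /(congr1 (fun m : mindex d => m j)); rewrite [RHS]ffunE => e0.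
    by have := leq_trans hj (he e j); rewrite e0.
  split=> //; first by apply: contra eB => /AB2.
  apply: lnAP; apply/eqP => /(congr1 (fun m : mindex d => m j));
    rewrite [RHS]ffunE => e0.
  have := hA (src e) j; rewrite pi_sumE (bigD1 e) //= e0 leqn0 addn_eq0.
  by rewrite eqn0Ngt hj.
have [|e|x|z [zA ze zn]] := @cut_exists _ _ AA t (lA l)
  [ffun e => lepsA l e + h e]
  [ffun x => [ffun j => (lnA l x j - pi_sum h x j)%N]].
- by [].
- rewrite ffunE; have [->|/h0[_ -> ->]//] := eqVneq (h e) 0.
  by rewrite addr0; apply: lepsAP.
- rewrite ffunE => /mindex_neq0[j]; rewrite ffunE => nj; apply: lnAP.
  by apply: contraNneq nj => ->; rewrite ffunE.
have [|e|x|w [wB we wn]] := @cut_exists _ _ AA (right_term i_gt0 A1 z) (lB l)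
  [ffun e : edge t => [ffun j => (lepsB l e j - h e j)%N]]
  [ffun x : node t => [ffun j => (lnB l x j - (lnA l x j - pi_sum h x j))%N]].
(* The colourings by [lA l] and by [cut_sub z] are built on different terms; eliminating [zA]
   identifies them. *)
- have hAz := hA1; rewrite -zA in hAz.
  suff : lB l \in AA (cup (cut_adm A1 z)) by [].
  rewrite (cup_mem _ _ (subforest_family_adm A1 hAz)).
  by case: _ / zA in hA1 hB1 hAz *;
    rewrite (cup_mem _ _ (subforest_family_adm A1 hA1)).
- rewrite ffunE => /mindex_neq0[j]; rewrite ffunE => nj.
  apply: (@cut_epsP _ _ AA t (tag l)).
  by apply: contraNneq nj => e0; rewrite /lepsB e0 [X in (X - _)%N]ffunE sub0n.
- rewrite ffunE => /mindex_neq0[j]; rewrite ffunE => nj.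
  apply: (@cut_nP _ _ AA t (tag l)).
  by apply: contraNneq nj => e0; rewrite /lnB e0 [X in (X - _)%N]ffunE sub0n.
pose r : right_cuts := existT _ z w.
have rBE : rB r = lB l by [].
have znE x j : rnA r x j = (lnA l x j - pi_sum h x j)%N.
  by rewrite /rnA /= zn [X in fun_of_fin X j]ffunE [LHS]ffunE.
have weE e j : repsB r e j = (lepsB l e j - h e j)%N.
  by rewrite /repsB /= we [X in fun_of_fin X j]ffunE [LHS]ffunE.
have wnE x j : rnB r x j = (lnB l x j - (lnA l x j - pi_sum h x j))%N.
  by rewrite /rnB /= wn [X in fun_of_fin X j]ffunE [LHS]ffunE.
(* On B both sides vanish, by [h0]; outside B the summand eps_A of eps'_A vanishes. *)
have outE : out_eps r = h.
  apply/ffunP => e; rewrite out_epsE rBE /repsA /= ze ffunE.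
  case: ifPn => [eB|eB]; last by rewrite lepsA_out // add0r.
  by apply/esym/eqP; apply: contraLR eB => /h0[].
exists r => //; split => //.
- by move=> e; rewrite outE /repsA /= ze ffunE.
- by move=> e; rewrite outE; apply/ffunP => j; rewrite mindexD weE subnKC.
- by move=> x; rewrite outE; apply/ffunP => j; rewrite mindexD znE subnK.
- by move=> x; apply/ffunP => j; rewrite mindexD znE wnE subnKC.
Qed.

Section Classes.
Variables (l : left_cuts) (r : right_cuts).
Hypothesis c : compat l r.

Lemma out_eps_in e : e \in (lB l).2 -> out_eps r e = 0.
Proof. by rewrite (compat_B c) out_epsE => ->. Qed.

Lemma repsA_in e : e \in (lB l).2 -> repsA r e = lepsA l e.
Proof. by move=> eB; rewrite (compat_repsA c) out_eps_in // addr0. Qed.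

Lemma repsA_out e : e \notin (lB l).2 -> repsA r e = out_eps r e.
Proof. by move=> eB; rewrite (compat_repsA c) lepsA_out // add0r. Qed.

Lemma rAB1 x : x \in (rA r).1 -> x \in (lB l).1.
Proof.
rewrite -(compat_A c); apply/fintype.subsetP.
by case/andP: (lA_included l).
Qed.

Lemma rAB2 x : x \in (rA r).2 -> x \in (lB l).2.
Proof.
rewrite -(compat_A c); apply/fintype.subsetP.
by case/andP: (lA_included l).
Qed.

Lemma pi_sumD (f g : edge t -> mindex d) x :
  pi_sum (fun e => f e + g e) x = pi_sum f x + pi_sum g x.
Proof. exact: big_split. Qed.

Lemma eq_pi_sum (f g : edge t -> mindex d) x : f =1 g -> pi_sum f x =
  pi_sum g x.
Proof. by move=> fg; apply: eq_bigr. Qed.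

(** Both factors are A, with node decoration n'_A + pi h + pi eps_A. *)
Lemma compat_left_left :
  \pi_(dforest_class d L)%qT (left_term (tagged l)) =
  \pi_(dforest_class d L)%qT (left_term (tag r)).
Proof.
have inN (x : node (left_term (tagged l))) : val (val x) \in (cut_sub (tag r)).1.
  by rewrite -/(rA r) -(compat_A c) -lAE1; apply: valP.
have inE' (x : edge (left_term (tagged l))) : val (val x) \in (cut_sub (tag r)).2.
  by rewrite -/(rA r) -(compat_A c) -lAE2; apply: valP.
pose gn x : node (left_term (tag r)) := small_elt (inN x).
pose ge x : edge (left_term (tag r)) := small_elt (inE' x).
apply: (@class_eq_of_maps _ _ _ _ gn ge) => //.
- by move=> x y [] /val_inj/val_inj.
- case=> y yA; have yB := rAB1 yA.
  have yA' : (small_elt yB : node (restr (lB l))) \in (cut_sub (tagged l)).1.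
    by rewrite lAE1 (compat_A c).
  by exists (small_elt yA'); apply: val_inj.
- by move=> x y [] /val_inj/val_inj.
- case=> y yA; have yB := rAB2 yA.
  have yA' : (small_elt yB : edge (restr (lB l))) \in (cut_sub (tagged l)).2.
    by rewrite lAE2 (compat_A c).
  by exists (small_elt yA'); apply: val_inj.
- by move=> e; apply: val_inj.
- by move=> e; apply: val_inj.
- move=> x; set y := val (val x) : node t.
  transitivity (rnA r y + pi_sum (repsA r) y); first by [].
  transitivity (lnA l y + pi_sum (lepsA l) y); last first.
    apply/esym; rewrite [LHS]/= /left_ndec lnAE; congr (_ + _).
    under eq_bigr => e _ do rewrite lepsAE.
    rewrite (sub_sum (lepsA l)); apply: eq_bigr => e _.
    by case: ifPn => // /lepsA_out.
  rewrite (compat_lnA c) (eq_pi_sum _ (compat_repsA c)) pi_sumD.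
  by rewrite -addrA [pi_sum (lepsA l) y + _]addrC.
Qed.

Lemma to_intD (m n : mindex d) : to_int (m + n) = to_int m + to_int n.
Proof. by apply/ffunP => j; rewrite !ffunE PoszD. Qed.

Lemma to_int0 : to_int (0 : mindex d) = 0.
Proof. by apply/ffunP => j; rewrite !ffunE. Qed.

Lemma to_int_sum (I : finType) (P : pred I) (F : I -> mindex d) :
  to_int (\sum_(e | P e) F e) = \sum_(e | P e) to_int (F e).
Proof. exact: (big_morph _ to_intD to_int0). Qed.

Lemma to_odecD (v w : {ffun 'I_d -> int}) :
  to_odec L (v + w) = to_odec L v + to_odec L w.
Proof. by rewrite /to_odec; congr pair; rewrite addr0. Qed.

(** On nodes, (n_B + pi eps_B) - n_A = n'_B + pi eps'_B, since n'_A and pi h cancel. On edges of B,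
    eps'_A = eps_A. *)
Lemma compat_right_left :
  \pi_(dforest_class d L)%qT (right_term i_gt0 A1 (tagged l)) =
  \pi_(dforest_class d L)%qT (left_term (tagged r)).
Proof.
have inN (x : node (right_term i_gt0 A1 (tagged l))) : val x \in (rB r).1.
  by rewrite -(compat_B c); apply: valP.
have inE' (x : edge (right_term i_gt0 A1 (tagged l))) : val x \in (rB r).2.
  by rewrite -(compat_B c); apply: valP.
pose gn x : node (left_term (tagged r)) := small_elt (inN x).
pose ge x : edge (left_term (tagged r)) := small_elt (inE' x).
apply: (@class_eq_of_maps _ _ _ _ gn ge) => //.
- by move=> x y [] /val_inj.
- case=> y yB; have yB' : y \in (lB l).1 by rewrite (compat_B c).
  by exists (small_elt yB'); apply: val_inj.
- by move=> x y [] /val_inj.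
- case=> y yB; have yB' : y \in (lB l).2 by rewrite (compat_B c).
  by exists (small_elt yB'); apply: val_inj.
- by move=> e; apply: val_inj.
- by move=> e; apply: val_inj.
- by move=> x; rewrite [RHS]/= /cup_ncol lAE1 (compat_A c).
- by move=> e; rewrite [RHS]/= /cup_ecol lAE2 (compat_A c).
- move=> x; set y := val x : node t.
  transitivity (rnB r y + pi_sum (repsB r) y); first by [].
  apply/ffunP => j; rewrite [RHS]ffunE lnAE -/y.
  rewrite -[@ndec d L (left_term (tag l)) x]/(lnB l y + pi_sum (lepsB l) y).
  rewrite (compat_lnA c) (compat_lnB c) (eq_pi_sum _ (compat_lepsB c)) pi_sumD.
  rewrite !mindexD addnACA [(_ + pi_sum (out_eps r) y j)%N]addnC.
  by rewrite addKn.
(* The sum for [r] runs over all edges leaving [y]; those outside B contribute pi h, the difference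
   between n_A and n'_A. *)
- move=> x; set y := val x : node t.
  transitivity (@odec d L t y + to_odec L (to_int (rnA r y) +
      \sum_(e | src e == y) (to_int (repsA r e) -
         (if e \in (rA r).2 then to_int (@edec d L t e) else 0)))); first by [].
  rewrite [RHS]/= /right_odec lnAE -/y; congr (_ + to_odec L _).
  under [in RHS]eq_bigr => e _ do rewrite lepsAE lAE2.
  rewrite (sub_sum (fun e => to_int (lepsA l e) -
    (if e \in (lA l).2 then to_int (@edec d L t e) else 0))).
  rewrite (compat_lnA c) to_intD to_int_sum -addrA -big_split; congr (_ + _).
  apply: eq_bigr => e _; rewrite (compat_A c) -/(lB l).
  case: (boolP (e \in (lB l).2)) => /= eB.
    by rewrite repsA_in // out_eps_in // to_int0 add0r.
  by rewrite repsA_out // ifN ?subr0 ?addr0 //; apply: contra eB; apply: rAB2.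
- move=> e; have eB : val e \in (lB l).2 by apply: valP.
  by rewrite [RHS]/= /right_edec lAE2 (compat_A c) lepsAE -repsA_in.
Qed.

(** As A is included in B, colouring A and then B is the same as colouring B. In the decoration
    [odec], the second cut removes eps'_A on the edges of B, and outside B one has eps'_A + eps'_B =
    h + eps'_B = eps_B. *)
Lemma compat_right_right :
  \pi_(dforest_class d L)%qT (right_term i_gt0 A1 (tag l)) =
  \pi_(dforest_class d L)%qT (right_term i_gt0 A1 (tagged r)).
Proof.
apply: (@class_eq_of_maps _ _ (right_term i_gt0 A1 (tag l))
  (right_term i_gt0 A1 (tagged r)) id id) => //; try by move=> y; exists y.
- move=> x.
  transitivity (if x \in (rB r).1 then i else if x \in (rA r).1 then i else ncol (c := t) x) => //.
  transitivity (if x \in (lB l).1 then i else ncol (c := t) x) => //.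
  rewrite (compat_B c); case: ifPn => // xB; rewrite ifN //.
  by apply: contra xB => /rAB1; rewrite (compat_B c).
- move=> x.
  transitivity (if x \in (rB r).2 then i else if x \in (rA r).2 then i else ecol (c := t) x) => //.
  transitivity (if x \in (lB l).2 then i else ecol (c := t) x) => //.
  rewrite (compat_B c); case: ifPn => // xB; rewrite ifN //.
  by apply: contra xB => /rAB2; rewrite (compat_B c).
- move=> x; apply/ffunP => j; rewrite [LHS]ffunE [RHS]ffunE.
  transitivity (@ndec d L t x j - rnA r x j - rnB r x j)%N.
    by congr subn; rewrite [LHS]ffunE.
  by rewrite -/(lnB l) (compat_lnB c) mindexD subnDA.
- move=> x.
  transitivity (@odec d L t x + to_odec L (to_int (rnA r x) +
      \sum_(e | src e == x) (to_int (repsA r e) -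
         (if e \in (rA r).2 then to_int (@edec d L t e) else 0))) +
    to_odec L (to_int (rnB r x) + \sum_(e | src e == x) (to_int (repsB r e) -
         (if e \in (rB r).2 then
            to_int ((if e \in (rA r).2 then 0 else @edec d L t e) + repsA r e)
          else 0)))); first by [].
  transitivity (@odec d L t x + to_odec L (to_int (lnB l x) +
      \sum_(e | src e == x) (to_int (lepsB l e) -
         (if e \in (lB l).2 then to_int (@edec d L t e) else 0)))); last by [].
  rewrite -addrA -to_odecD addrACA -big_split (compat_lnB c) to_intD.
  congr (_ + to_odec L (_ + _)); apply: eq_bigr => e _ /=.
  rewrite (compat_lepsB c) -(compat_B c) to_intD.
  case: (boolP (e \in (lB l).2)) => eB.
    rewrite out_eps_in // to_int0 add0r addrCA; congr (_ + _).
    rewrite to_intD [to_int _ + to_int _]addrC opprD addrACA subrr add0r.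
    by case: ifP => _; rewrite ?to_int0 ?oppr0 ?addr0 ?sub0r ?add0r.
  rewrite repsA_out // ifN ?subr0 //.
  by apply: contra eB; apply: rAB2.
- move=> e.
  transitivity ((if e \in (rB r).2 then 0 else
     (if e \in (rA r).2 then 0 else @edec d L t e) + repsA r e) + repsB r e) =>
       //.
  transitivity ((if e \in (lB l).2 then 0 else @edec d L t e) + lepsB l e) =>
    //.
  rewrite (compat_lepsB c) -(compat_B c) addrA; congr (_ + _).
  case: (boolP (e \in (lB l).2)) => eB.
    by rewrite out_eps_in ?addr0.
  by rewrite repsA_out // ifN //; apply: contra eB; apply: rAB2.
Qed.
End Classes.
End CompatibleCuts.


(** * Coefficients of iterated cuts *)

Lemma fsum_finType (R : realType) (I : finType) (F : I -> R) :
  (\sum_(i \in [set: I]) F i = \sum_i F i)%R.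
Proof.
rewrite (fsbigE (index_enum I)) ?index_enum_uniq //.
  by apply: eq_bigl => x; rewrite in_setT.
by move=> x _; rewrite mem_index_enum.
Qed.

(** Both sides equal n! / (a! b! (n - a - b)!) if a + b <= n, and vanish otherwise. *)
Lemma bin_split n a b : 'C(n, a) * 'C(n - a, b) = 'C(n, a + b) * 'C(a + b, a).
Proof.
have [abn|] := leqP (a + b) n; last first.
  move=> nab; rewrite ['C(n, a + b)]bin_small // mul0n.
  have [an|na] := leqP a n; last by rewrite bin_small.
  by rewrite ['C(n - a, b)]bin_small ?muln0 // ltn_subLR.
have an : a <= n by apply: leq_trans abn; apply: leq_addr.
have ban : b <= n - a by rewrite leq_subRL.
apply/eqP; rewrite -(@eqn_pmul2r (a`! * b`! * (n - a - b)`!)); last first.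
  by rewrite !muln_gt0 !fact_gt0.
apply/eqP; transitivity (n`!).
  by rewrite -(bin_fact an) -(bin_fact ban) -!mulnA; congr muln; rewrite mulnCA.
by rewrite -(bin_fact abn) -(bin_fact (leq_addr b a)) addKn subnDA -!mulnA.
Qed.

Lemma prod_small (N : smallFinType) (A : {set N}) (F : N -> nat) :
  (forall x, x \notin A -> F x = 1) ->
  \prod_(x : small_sub A) F (val x) = \prod_x F x.
Proof.
move=> F1; rewrite [RHS](bigID (mem A)) /= [X in _ * X]big1 // muln1.
exact/esym/(@big_sub nat 1%N muln N (mem A) F).
Qed.

Section Coefficients.
Context {d : nat} {L : finType} {AA : subforest_family L} {R : realType}.
Context {i : nat} (i_gt0 : 0 < i) (A1 : assumption1 i AA).
Context (t : dforest d L).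
Hypothesis A2 : assumption2 A1.
Local Notation left_cuts := (left_cuts (AA := AA) t).
Local Notation right_cuts := (right_cuts i_gt0 A1 t).

Definition left_coef (l : left_cuts) : R :=
  (cut_coef R (tag l) * cut_coef R (tagged l))%R.

Definition right_coef (r : right_cuts) : R :=
  (cut_coef R (tag r) * cut_coef R (tagged r))%R.

(** The factor shared by the coefficient of [l] and those of all right cuts compatible with [l]. *)
Definition base_coef (l : left_cuts) : R :=
  ((\prod_x \prod_j 'C(@ndec d L t x j, lnB l x j))%N%:R /
   ((\prod_e \prod_j (lepsB l e j)`!)%N%:R *
    (\prod_e \prod_j (lepsA l e j)`!)%N%:R))%R.

(** The summand of index [h] in the Vandermonde identity; the boolean guards the truncated
    subtraction. *)
Definition split_weight (l : left_cuts) (h : {ffun edge t -> mindex d}) : nat :=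
  (\prod_x \prod_j ((pi_sum h x j <= lnA l x j) *
                    'C(lnB l x j, lnA l x j - pi_sum h x j))) *
  \prod_e \prod_j 'C(lepsB l e j, h e j).

(** The second cut sees the node decoration n_B + pi eps_B. Its products over B extend to [t], since
    the factors outside B are 0! or binomials with lower entry 0. *)
Lemma left_coefE l : left_coef l = (base_coef l *
  (\prod_x \prod_j 'C(lnB l x j + pi_sum (lepsB l) x j, lnA l x j))%N%:R)%R.
Proof.
rewrite /left_coef /base_coef invfM [X in _ = (X * _)%R]mulrA -[RHS]mulrA.
rewrite [X in _ = (_ * X)%R]mulrC; congr (_ * (_%:R / _%:R))%R; last first.
  rewrite -(prod_small (A := (lB l).2)).
    by apply: eq_bigr => e _; apply: eq_bigr => j _; rewrite lepsAE.
  by move=> e eB; rewrite big1 // => j _; rewrite lepsA_out // ffunE.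
rewrite -(prod_small (A := (lB l).1)).
  apply: eq_bigr => x _; apply: eq_bigr => j _; rewrite lnAE; congr 'C(_, _).
  rewrite -mindexD; congr (fun_of_fin _ j).
by move=> x xB; rewrite big1 // => j _; rewrite lnA_out // ffunE bin0.
Qed.

(** Provides the hypotheses of [compat_ex_right]. *)
Lemma split_weight_neq0 l h : split_weight l h != 0 ->
  [/\ forall x j, pi_sum h x j <= lnA l x j,
      forall x j, lnA l x j - pi_sum h x j <= lnB l x j &
      forall e j, h e j <= lepsB l e j].
Proof.
rewrite muln_eq0 negb_or -!lt0n => /andP[hx he]; split=> [x j|x j|e j].
- by move: hx; rewrite (bigD1 x) //= (bigD1 j) //= !muln_gt0 lt0b =>
    /andP[/andP[/andP[]]].
- move: hx; rewrite (bigD1 x) //= (bigD1 j) //= !muln_gt0 bin_gt0.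
  by move=> /andP[/andP[/andP[]]].
- by move: he; rewrite (bigD1 e) //= (bigD1 j) //= !muln_gt0 bin_gt0 =>
    /andP[/andP[]].
Qed.

(** [Vandermonde_fibers] for the map (e, j) to (src e, j), which treats all components of the
    multi-indices at once. *)
Lemma sum_split_weight l :
  (\sum_(h \in [set: {ffun edge t -> mindex d}]%classic) ((split_weight l h)%:R : R) =
   (\prod_x \prod_j 'C(lnB l x j + pi_sum (lepsB l) x j, lnA l x j))%N%:R)%R.
Proof.
(* [K] bounds the components of eps_B, hence those of every [h] of non-zero weight, so the sum
   becomes one over functions into ['I_K.+1]. *)
pose K := \sum_e msize (lepsB l e).
have leK e j : lepsB l e j <= K.
  by rewrite /K (bigD1 e) // /msize (bigD1 j) //= -!addnA leq_addr.
pose g (k : {ffun edge t * 'I_d -> 'I_K.+1}) : {ffun edge t -> mindex d} :=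
  [ffun e => [ffun j => k (e, j) : nat]].
have gE k e j : g k e j = k (e,
  j) by rewrite [X in fun_of_fin X j]ffunE [LHS]ffunE.
have fiber (F : edge t * 'I_d -> nat) x j :
    \sum_(p : edge t * 'I_d | (src p.1, p.2) == (x, j)) F p =
    \sum_(e | src e == x) F (e, j).
  rewrite (eq_bigl (fun p : edge t * 'I_d => (src p.1 == x) && (p.2 == j))) //.
  rewrite (eq_bigr (fun p => F (p.1, p.2))); last by case.
  rewrite -(pair_big (fun e => src e == x) (pred1 j) (fun e j => F (e, j))) /=.
  by apply: eq_bigr => e _; rewrite big_pred1_eq.
rewrite (fsum_reindex (h := g)); last 2 first.
- move=> k k' kk'; apply/ffunP => -[e j]; apply: val_inj.
  by rewrite /= -!gE kk'.
- move=> h; rewrite pnatr_eq0 => /split_weight_neq0[_ _ hk].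
  exists [ffun p => inord (h p.1 p.2)]; apply/ffunP => e; apply/ffunP => j.
  by rewrite gE ffunE inordK // ltnS; apply: leq_trans (leK e j).
have -> : (\prod_x \prod_j 'C(lnB l x j + pi_sum (lepsB l) x j, lnA l x j) =
    \prod_(y : node t * 'I_d) 'C(lnB l y.1 y.2 +
      \sum_(p : edge t * 'I_d | (src p.1, p.2) == y) lepsB l p.1 p.2,
        lnA l y.1 y.2)).
  rewrite pair_big; apply: eq_bigr => -[x j] _ /=.
  by rewrite (fiber (fun p => lepsB l p.1 p.2)) pi_sumE.
rewrite fsum_finType (@Vandermonde_fibers R _ _ (fun p => (src p.1,
  p.2)) _ _ _ K); last first.
  by case.
apply: eq_bigr => k _; congr (_%:R)%R; rewrite /split_weight !pair_big /=.
congr muln; last by apply: eq_bigr => -[e j] _; rewrite gE.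
apply: eq_bigr => -[x j] _ /=; rewrite (fiber (fun p => k p)) pi_sumE.
by under [in LHS]eq_bigr => e _ do rewrite gE.
Qed.

(** On nodes, [bin_split] rewrites C(n, n'_A) C(n - n'_A, n'_B) as C(n, n_B) C(n_B, n'_A). On edges,
    eps'_A! = eps_A! h! because the supports are disjoint, and eps_B! = C(eps_B, h) h! eps'_B!. *)
Lemma right_coefE l r : compat l r ->
  right_coef r = (base_coef l * (split_weight l (out_eps r))%:R)%R.
Proof.
move=> c.
have prodM (I : finType) (F G : I -> 'I_d -> nat) :
    (\prod_x \prod_j F x j) * (\prod_x \prod_j G x j) =
    \prod_x \prod_j (F x j * G x j).
  by rewrite -big_split; apply: eq_bigr => x _; rewrite -big_split.
have prod_gt0 (I : finType) (F : I -> 'I_d -> nat) :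
    (forall x j, 0 < F x j) -> 0 < \prod_x \prod_j F x j.
  by move=> F0; apply: prodn_gt0 => x; apply: prodn_gt0.
set h := out_eps r.
set Q := \prod_e \prod_j 'C(lepsB l e j, h e j).
(* [Q] enters both sides of the factorial identity [eY] in division-free form and is cancelled at
   the end. *)
have Q0 : 0 < Q.
  apply: prod_gt0 => e j; rewrite bin_gt0 (compat_lepsB c) mindexD;
    exact: leq_addr.
set Z := \prod_x \prod_j ((pi_sum h x j <= lnA l x j) *
                    'C(lnB l x j, lnA l x j - pi_sum h x j)).
have eX : (\prod_x \prod_j 'C(@ndec d L t x j, rnA r x j)) *
    (\prod_x \prod_j 'C(@ndec d L t x j - rnA r x j, rnB r x j)) =
    (\prod_x \prod_j 'C(@ndec d L t x j, lnB l x j)) * Z.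
  rewrite !prodM; apply: eq_bigr => x _; apply: eq_bigr => j _.
  rewrite bin_split (compat_lnA c) (compat_lnB c) !mindexD addnK leq_addl.
  by rewrite mul1n.
have eY : (\prod_e \prod_j (repsA r e j)`!) * (\prod_e \prod_j (repsB r e j)`!) * Q =
    (\prod_e \prod_j (lepsB l e j)`!) * (\prod_e \prod_j (lepsA l e j)`!).
  rewrite !prodM; apply: eq_bigr => e _; apply: eq_bigr => j _.
  have -> : (repsA r e j)`! = (lepsA l e j)`! * (h e j)`!.
    rewrite (compat_repsA c) mindexD /h.
    case: (boolP (e \in (lB l).2)) => eB.
      by rewrite (out_eps_in c eB) [X in _ +
        X]ffunE [X in _ * X`!]ffunE addn0 muln1.
    by rewrite (lepsA_out eB) [X in X + _]ffunE [X in X`! * _]ffunE add0n mul1n.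
  have le : h e j <= lepsB l e j by rewrite (compat_lepsB c) mindexD leq_addr.
  rewrite -(bin_fact le) (compat_lepsB c) mindexD addKn.
  by rewrite [LHS]mulnC -[RHS]mulnA; congr muln; rewrite [RHS]mulnC mulnA.
have -> : right_coef r = (((\prod_x \prod_j 'C(@ndec d L t x j,
  rnA r x j))%N%:R /
      (\prod_e \prod_j (repsA r e j)`!)%N%:R) *
    ((\prod_x \prod_j 'C(@ndec d L t x j - rnA r x j, rnB r x j))%N%:R /
      (\prod_e \prod_j (repsB r e j)`!)%N%:R))%R.
  rewrite /right_coef; congr (_ * (_%:R / _))%R; apply: eq_bigr => x _.
  apply: eq_bigr => j _; congr 'C(_, _); exact: ffunE.
rewrite mulf_div /base_coef -!natrM eX -eY -[split_weight l h]/(Z * Q).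
rewrite [X in (X / _)%R = _]natrM [X in _ = (_ / X * _)%R]natrM invfM.
rewrite [X in _ = (_ * X)%R]natrM -[LHS]mulrA -[RHS]mulrA; congr (_ * _)%R.
by rewrite mulrACA mulVf ?mulr1 1?mulrC // pnatr_eq0 -lt0n.
Qed.

End Coefficients.

(** * Coassociativity *)


Section Coassociative.
Local Open Scope classical_set_scope.
Local Open Scope ring_scope.
Context {d : nat} {L : finType} {AA : subforest_family L} {R : realType}.
Context {i : nat} (i_gt0 : (0 < i)%N) (A1 : assumption1 i AA).
Local Notation left_cuts := (left_cuts (AA := AA)).
Local Notation right_cuts := (right_cuts i_gt0 A1).
Local Notation FF := (FF d L).
Local Notation FF3 := (tensor (tensor FF FF) FF).
Implicit Types (t : dforest d L) (w : FF3).

Definition left_triple t (l : left_cuts t) : FF3 :=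
  (cut_term i_gt0 A1 (tagged l),
   \pi_(dforest_class d L)%qT (right_term i_gt0 A1 (tag l))).

(** Bracketed to the left, to be comparable with [left_triple]. *)
Definition right_triple t (r : right_cuts t) : FF3 :=
  ((\pi_(dforest_class d L)%qT (left_term (tag r)),
    (cut_term i_gt0 A1 (tagged r)).1), (cut_term i_gt0 A1 (tagged r)).2).

Lemma compat_triple t (l : left_cuts t) (r : right_cuts t) :
  compat l r -> left_triple l = right_triple r.
Proof.
move=> c; rewrite /left_triple /right_triple /cut_term /=.
by rewrite (compat_left_left c) (compat_right_left c) (compat_right_right c).
Qed.

(** The first degree of [w] bounds that of the term of the second cut, which in turn dominates that
    of [left_term z]; so the terms of both cuts are bounded. *)
Lemma left_finite t w : finite_set
  [set l : left_cuts t | left_coef (R := R) l * (left_triple l == w)%:R != 0].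
Proof.
pose n := (bideg w).1.
apply: sub_finite_set (finite_sigma (finite_cut_term (R := R) i_gt0 A1 t n)
  (fun z _ => finite_cut_term (R := R) i_gt0 A1 (left_term z) n)) => -[z z'].
rewrite [X in X -> _]/= mulf_eq0 negb_or => /andP[].
rewrite mulf_eq0 negb_or => /andP[cz cz'] lw.
have {lw}ew : left_triple (existT _ z z') = w.
  by case: (left_triple _ =P w) lw => //; rewrite eqxx.
have nE : n = ((bideg (cut_term i_gt0 A1 z')).1 +
               (dforest_bideg (right_term i_gt0 A1 z)).1)%N.
  by rewrite /n -ew -(class_bideg_pi (right_term i_gt0 A1 z)).
have z'n : ((bideg (cut_term i_gt0 A1 z')).1 <= n)%N by rewrite nE leq_addr.
split=> //; split=> //; rewrite [tag _]/= cut_term_bideg nE;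
  apply: leq_add => //.
by rewrite cut_term_deg1 leq_addr.
Qed.

Lemma right_finite t w : finite_set
  [set r : right_cuts t | right_coef (R :=
    R) r * (right_triple r == w)%:R != 0].
Proof.
pose n := (bideg w).1.
apply: sub_finite_set (finite_sigma (finite_cut_term (R := R) i_gt0 A1 t n)
  (fun z _ => finite_cut_term (R :=
    R) i_gt0 A1 (right_term i_gt0 A1 z) n)) => -[z z'].
rewrite [X in X -> _]/= mulf_eq0 negb_or => /andP[].
rewrite mulf_eq0 negb_or => /andP[cz cz'] lw.
have {lw}ew : right_triple (existT _ z z') = w.
  by case: (right_triple _ =P w) lw => //; rewrite eqxx.
have nE : n = ((dforest_bideg (left_term z)).1 +
               (bideg (cut_term i_gt0 A1 z')).1)%N.
  by rewrite /n -ew -(class_bideg_pi (left_term z)) /= addnA.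
have z'n : ((bideg (cut_term i_gt0 A1 z')).1 <= n)%N by rewrite nE leq_addl.
split=> //; split=> //; rewrite [tag _]/= cut_term_bideg nE;
  apply: leq_add => //.
by rewrite cut_term_deg1 leq_addr.
Qed.

(** Right cuts are re-indexed by pairs of a left cut and a function h; summing over h first gives
    the left coefficients, by [sum_split_weight]. *)
Lemma sum_left_right t w : assumption2 A1 ->
  \sum_(l \in [set: left_cuts t]) left_coef (R :=
    R) l * (left_triple l == w)%:R =
  \sum_(r \in [set: right_cuts t])
     right_coef (R := R) r * (right_triple r == w)%:R.
Proof.
move=> A2; have /choice[f fP] : forall r : right_cuts t, exists l, compat l r.
  by move=> r; apply: compat_ex_left.
(* [phi] is injective by [compat_inj_right], and reaches every pair of non-zero weight by
   [compat_ex_right]. *)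
pose phi r := (f r, out_eps r).
pose G (p : left_cuts t * {ffun edge t -> mindex d}) : R :=
  base_coef p.1 * (split_weight p.1 p.2)%:R * (left_triple p.1 == w)%:R.
have GE r : G (phi r) = right_coef (R := R) r * (right_triple r == w)%:R.
  by rewrite /G /= -(right_coefE (fP r)) (compat_triple (fP r)).
have phi_inj : injective phi.
  move=> r r' [frr' out]; apply: (compat_inj_right (fP r)) => //.
  by rewrite frr'; apply: fP.
have phi_surj p : G p != 0 -> exists r, phi r = p.
  case: p => l h; rewrite mulf_eq0 negb_or => /andP[+ _].
  rewrite mulf_eq0 negb_or pnatr_eq0 => /andP[_ /split_weight_neq0[h1 h2 h3]].
  have [r lr rh] := compat_ex_right i_gt0 A2 h1 h2 h3; exists r;
    congr pair => //.
  exact: compat_inj_left (fP r) lr.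
transitivity (\sum_(p \in setT) G p); last first.
  rewrite (fsum_reindex phi_inj phi_surj); exact: eq_fsbigr.
rewrite fsum_pair; last first.
  (* The support of [G] is finite as the image under [phi] of finitely many right cuts. *)
  apply: sub_finite_set (finite_image phi (right_finite t w)) => p Gp.
  by have [r rp] := phi_surj _ Gp; exists r => //=; rewrite -GE rp.
apply: eq_fsbigr => l _.
transitivity (\sum_(h \in setT)
    base_coef (R := R) l * (split_weight l h)%:R * (left_triple l == w)%:R);
      last by [].
by rewrite -mulr_fsuml -mulr_fsumr sum_split_weight -left_coefE.
Qed.

Lemma map_tensor_neq0 (X X' Y Y' : bigraded) (phi : bgmap R X X')
    (psi : bgmap R Y Y') (z : tensor X Y) (y : tensor X' Y') :
  map_tensor phi psi z y != 0 -> ((bideg z).1 <= (bideg y).1)%N.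
Proof. by case/on_basisP. Qed.

Lemma Delta_id_coef t a b c :
  Delta_id i_gt0 A1 (Delta_series i_gt0 A1 t R) ((a, b), c) =
  \sum_(l \in [set: left_cuts t])
     left_coef (R := R) l * (left_triple l == ((a, b), c))%:R.
Proof.
rewrite [LHS](@Delta_sum _ _ _ _ _ _ _ _ _ (bideg ((a, b, c) : FF3)).1);
  last first.
  by move=> y /map_tensor_neq0.
rewrite fsum_sigma; last exact: left_finite.
apply: eq_fsbigr => z _; rewrite [X in _ * X]/= /tens_coef /= /delta_coef.
(* The inner coproduct is taken at the representative of the class of [left_term z], which is
   replaced by [left_term z]. *)
rewrite (Delta_iso _ i_gt0 A1 _ (class_repr _)).
rewrite /Delta_dforest mulr_fsuml mulr_fsumr; apply: eq_fsbigr => z' _.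
rewrite /left_coef /left_triple /= [in RHS]xpair_eqE [c == _]eq_sym.
by rewrite -mulnb natrM !mulrA.
Qed.

Lemma id_Delta_coef t a b c :
  id_Delta i_gt0 A1 (Delta_series i_gt0 A1 t R) (a, (b, c)) =
  \sum_(r \in [set: right_cuts t])
     right_coef (R := R) r * (right_triple r == ((a, b), c))%:R.
Proof.
rewrite [LHS](@Delta_sum _ _ _ _ _ _ _ _ _ (bideg ((a, (b,
  c)) : tensor FF (tensor FF FF))).1); last first.
  by move=> y /map_tensor_neq0.
rewrite fsum_sigma; last exact: right_finite.
apply: eq_fsbigr => z _; rewrite [X in _ * X]/= /tens_coef /= /delta_coef.
rewrite (Delta_iso _ i_gt0 A1 _ (class_repr _)).
rewrite /Delta_dforest mulr_fsumr mulr_fsumr; apply: eq_fsbigr => z' _.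
rewrite /right_coef /right_triple /= !xpair_eqE [a == _]eq_sym.
rewrite -[in RHS]andbA -[in RHS]mulnb natrM -[RHS]mulrA; congr (_ * _).
exact: mulrCA.
Qed.

(** Both sides are extensions of maps on the basis, so one forest suffices; there the identity is
    [sum_left_right]. *)
Lemma Delta_coassoc (f : series R FF) : assumption2 A1 ->
  extend (bgassoc FF FF FF) (Delta_id i_gt0 A1 (Delta i_gt0 A1 f)) =
  id_Delta i_gt0 A1 (Delta i_gt0 A1 f).
Proof.
move=> A2; rewrite /Delta_id /id_Delta /Delta !extend_comp.
apply: eq_extend => x [a [b c]].
transitivity (extend (bgassoc FF FF FF)
    (Delta_id i_gt0 A1 (Delta_series i_gt0 A1 (repr x) R)) (a, (b, c))).
  by rewrite /Delta_id extend_comp.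
rewrite extend_assoc Delta_id_coef sum_left_right //.
by rewrite -id_Delta_coef.
Qed.

End Coassociative.

Theorem proposition3p11 (R : realType) (d : nat) (d_gt0 : 0 < d)
    (L : finType) (i : nat) (i_gt0 : 0 < i) (AA : subforest_family L)
    (A1 : assumption1 i AA) (A2 : assumption2 A1) :
  (forall f : series R (FF d L),
     extend (bgassoc (FF d L) (FF d L) (FF d L))
       (Delta_id i_gt0 A1 (Delta i_gt0 A1 f)) =
     id_Delta i_gt0 A1 (Delta i_gt0 A1 f)) /\
  (forall f g : series R (FF d L),
     Delta i_gt0 A1 (forest_prod f g) =
     forest_prod2 (Delta i_gt0 A1 f) (Delta i_gt0 A1 g)).
Proof.
split=> [f|f g]; [exact: Delta_coassoc|exact: Delta_mul].
Qed.
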